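(* Let $\phi:[0,1]\to[0,1]$ be concave with $\phi(0)=0$, $\phi(1)=1$. Then all ri function norms $R$ with fundamental function $\phi$ coincide on $\mathcal{M}^+$, and moreover $\|X\|_{M_\phi}=R(X)=\|X\|_{\Lambda_\phi}$ for all $X\in\mathcal{M}^+$, if and only if either $\phi(t)=\min\{t/(1-\alpha),1\}$ for some $\alpha\in[0,1)$, in which case all these equal $\operatorname{CVar}_\alpha(X)=\frac{1}{1-\alpha}\int_0^{1-\alpha}X^*(\omega)\,d\omega$, or $\phi=\chi_{(0,1]}$ (the limit $\alpha\to1$), in which case all these equal $\|X\|_{\mathcal{L}^\infty}=\operatorname{ess\,sup} X$.
   Context: $\Omega=[0,1]$ with Lebesgue measure $\mu$; $\mathcal{M}$ measurable functions, $\mathcal{M}^+$ those with values in $[0,\infty]$. A Banach function norm is $R:\mathcal{M}^+\to[0,\infty]$ with: $R(X)=0\iff X=0$, positive homogeneity, subadditivity; monotonicity $0\le X\le Y\Rightarrow R(X)\le R(Y)$; Fatou property $0\le X_n\uparrow X$ a.e. $\Rightarrow R(X_n)\uparrow R(X)$; $R(\chi_E)<\infty$ and $\int_E X\,d\mu\le c_E R(X)$ for a constant $c_E$ depending only on $E,R$; normalised $R(\chi_\Omega)=1$. It is an ri function norm if $R(X)=R(Y)$ for equimeasurable $X,Y$ (same distribution function $\lambda\mapsto\mu\{|X|>\lambda\}$). Decreasing rearrangement: $X^*(\omega)=\inf\{\lambda\ge0:\mu\{|X|>\lambda\}\le\omega\}$, $X^*(0)=\operatorname{ess\,sup}|X|$.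 Fundamental function: $\phi_R(t)=R(\chi_E)$, $\mu(E)=t$. Lorentz norm: $\|X\|_{\Lambda_\phi}=X^*(0)\phi(0+)+\int_0^1X^*(\omega)\phi'(\omega)\,d\omega$. Marcinkiewicz norm: $\|X\|_{M_\phi}=\sup_{0<t\le1}\frac{\phi(t)}{t}\int_0^tX^*(\omega)\,d\omega$. Both are ri norms with fundamental function $\phi$. *)

(* Defs.v *)
From HB Require Import structures.
From mathcomp Require Import all_boot all_order all_algebra.
From mathcomp Require Import all_classical all_reals all_analysis.
From mathcomp Require Import measurable_realfun ess_sup_inf.
Set Implicit Arguments. Unset Strict Implicit. Unset Printing Implicit Defensive.
Import Order.TTheory GRing.Theory Num.Theory.
Import numFieldNormedType.Exports.
Local Open Scope classical_set_scope.
Local Open Scope ring_scope.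

Section Defs.
Context {R : realType}.

Definition I01 : set R := `[0%R, 1%R].

Definition mu01 := mrestr (@lebesgue_measure R) (measurable_itv `[0%R, 1%R]).

Definition Mplus (X : R -> \bar R) : Prop :=
  measurable_fun I01 X /\ (forall x, I01 x -> (0 <= X x)%E).

Definition ae01 (P : R -> Prop) : Prop := \forall x \ae mu01, P x.

Definition ind (E : set R) : R -> \bar R := fun x => (\1_E x)%:E.

Definition distr (X : R -> \bar R) (l : R) : \bar R :=
  lebesgue_measure (I01 `&` [set x | (l%:E < `|X x|)%E]).

Definition equimeasurable (X Y : R -> \bar R) : Prop :=
  forall l : R, distr X l = distr Y l.

Definition Xstar (X : R -> \bar R) (w : R) : \bar R :=
  ereal_inf [set l%:E | l in [set l : R | 0 <= l /\ (distr X l <= w%:E)%E]].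

Definition banach_function_norm (Rn : (R -> \bar R) -> \bar R) : Prop :=
      (forall X, Mplus X -> (Rn X = 0%E <-> ae01 (fun x => X x = 0%E))) /\
      (forall X (c : R), Mplus X -> 0 <= c ->
         Rn (fun x => (c%:E * X x)%E) = (c%:E * Rn X)%E) /\
      (forall X Y, Mplus X -> Mplus Y -> (Rn (X \+ Y) <= Rn X + Rn Y)%E) /\
      (forall X Y, Mplus X -> Mplus Y -> ae01 (fun x => (X x <= Y x)%E) ->
         (Rn X <= Rn Y)%E) /\
      (forall (Xn : nat -> R -> \bar R) X, (forall n, Mplus (Xn n)) -> Mplus X ->
         ae01 (fun x => ({homo (fun n => Xn n x) : n m / (n <= m)%N >-> (n <= m)%E})
                        /\ ((fun n => Xn n x) @ \oo --> X x)) ->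
         ((fun n => Rn (Xn n)) @ \oo --> Rn X)) /\
      (forall E, measurable E -> E `<=` I01 ->
         (Rn (ind E) < +oo)%E /\
         exists cE : R, forall X, Mplus X ->
           (\int[lebesgue_measure]_(x in E) X x <= cE%:E * Rn X)%E) /\
      Rn (ind I01) = 1%E.

Definition ri_function_norm (Rn : (R -> \bar R) -> \bar R) : Prop :=
  banach_function_norm Rn /\
  (forall X Y, Mplus X -> Mplus Y -> equimeasurable X Y -> Rn X = Rn Y).

Definition has_fundamental_function (Rn : (R -> \bar R) -> \bar R) (phi : R -> R) : Prop :=
  forall E, measurable E -> E `<=` I01 ->
    Rn (ind E) = (phi (fine (lebesgue_measure E)))%:E.

Definition concave_on01 (phi : R -> R) : Prop :=
  forall x y t, I01 x -> I01 y -> 0 <= t <= 1 ->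
    t * phi x + (1 - t) * phi y <= phi (t * x + (1 - t) * y).

Definition lorentz_norm (phi : R -> R) (X : R -> \bar R) : \bar R :=
  (Xstar X 0 * (lim (phi x @[x --> 0%R^'+]))%:E +
   \int[lebesgue_measure]_(w in `]0%R, 1%R]) (Xstar X w * (derive1 phi w)%:E))%E.

Definition marcinkiewicz_norm (phi : R -> R) (X : R -> \bar R) : \bar R :=
  ereal_sup [set ((phi t / t)%:E *
                  \int[lebesgue_measure]_(w in `[0%R, t]) Xstar X w)%E
            | t in `]0%R, 1%R]].

Definition CVaR (alpha : R) (X : R -> \bar R) : \bar R :=
  (((1 - alpha)^-1)%:E * \int[lebesgue_measure]_(w in `[0%R, (1 - alpha)%R]) Xstar X w)%E.

Definition Linf_norm (X : R -> \bar R) : \bar R := ess_sup mu01 X.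

End Defs.

(* Main.v *)
Require Import Defs.
From HB Require Import structures.
From mathcomp Require Import all_boot all_order all_algebra.
From mathcomp Require Import all_classical all_reals all_analysis.
From mathcomp Require Import measurable_realfun ess_sup_inf.
From mathcomp Require Import lra ring zify.
Import Order.TTheory GRing.Theory Num.Theory.
Import numFieldNormedType.Exports.
Local Open Scope classical_set_scope.
Local Open Scope ring_scope.

(* Write K(t, X) for the integral of X^* over [0, t]. For l >= 0 one has
   K(t, X) <= l t + \int (X - l)^+, with equality at l = X^*(t); this makes K(t, -) subadditive.
   If phi(t) = min(t/b, 1), splitting X into min(X, l) and (X - l)^+ gives R(X) <= K(b, X) / b,
   and applying R(Z) <= (1/b) \int Z to Z = (M - min(X^*, M)) 1_[0, b] gives the reverse inequality.
   Conversely, the supremum of all a K(t, X) + b K(1, X) with a, b >= 0 and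
   a min(t, u) + b u <= phi(u) on [0, 1] is an ri norm with fundamental function phi, so by hypothesis
   it equals the Marcinkiewicz norm. It is at least 1 + phi(s) at X = 1 + 1_[0, s], and comparing with
   the Marcinkiewicz norm of X forces phi(s) <= s / u whenever s < u and phi(u) < 1, so phi is linear
   until it reaches 1. *)

(** All norms with fundamental function phi agree on multiples of indicators, so telling two of them
    apart takes a function with at least two nonzero values, and 1 + 1_[0, s] is the simplest. Its
    Lorentz norm is phi(1) + phi(s), while the Marcinkiewicz norm sees phi at one point t at a time.
    The supremum replaces the Lorentz norm because it asks nothing of phi', and one of its terms
    already reaches 1 + phi(s). A lower bound for R cannot be read off from \int_E X <= c R(X),
    whose constant is unspecified. Passing to a complement works because R(Z) <= (1/b) \int Z is an
    equality at Z = 1_[0, b]: whatever the complement cannot supply must come from X^*. Truncation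
    at M keeps the differences finite. The jump function chi_(0,1] lies below no line c u, so
    integral bounds fail for it; there R(X) is compared with l R(1_{X > l}) = l. In the converse,
    the two alternatives are separated by whether phi < 1 somewhere on ]0, 1]; if so, b is the
    supremum of such points. *)

Section RearrangementInvariantNorms.
#[local] Set Implicit Arguments.
#[local] Unset Strict Implicit.
Context {R : realType}.
Local Notation lam := (@lebesgue_measure R).
Implicit Types (X Y : R -> \bar R) (l w t : R) (phi : R -> R).

(** * Dyadic layer approximation of nonnegative extended reals *)

(* Approximation by a sum of indicators of nested superlevel sets {x > (k+1) h}: its integral then
   depends on the distribution function only. *)
Definition layers (h : R) (N : nat) (x : \bar R) : R :=
  \sum_(k < N) h * (((k.+1)%:R * h)%:E < x)%E%:R.

Definition layer (n : nat) (x : \bar R) : R :=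
  layers (2 ^- n) (n * 2 ^ n) x.

Lemma layersS (h : R) (N : nat) (x : \bar R) :
  layers h N.+1 x = layers h N x + h * ((N.+1%:R * h)%:E < x)%E%:R.
Proof. by rewrite /layers big_ord_recr. Qed.

(** For positive [h] and [r] the sum is [h] times the number of multiples of [h] in []0, r[], capped
    at [N]; the strict comparison loses at most one step, whence the [- h] on the left. *)
Lemma layers_bounds (h r : R) (N : nat) : 0 <= h -> 0 <= r ->
  Num.min r (N.+1%:R * h) - h <= layers h N r%:E <= Num.min r (N%:R * h).
Proof.
move=> h0 r0; have e (k : nat) : k.+1%:R * h = k%:R * h + h.
  by rewrite mulrSr mulrDl mul1r.
elim: N => [|N].
  rewrite /layers big_ord0 mul0r mul1r; apply/andP; split; last by rewrite le_min r0/=.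
  by rewrite subr_le0 ge_min lexx orbT.
rewrite layersS lte_fin !e.
have : 0 <= N%:R * h by rewrite mulr_ge0.
move: (N%:R * h) (layers h N r%:E) => u v u0.
case: (ltP (u + h) r) => /= H3; rewrite ?mulr1 ?mulr0 ?addr0;
rewrite !minElt; case: ifPn; rewrite ?ltNge ?negbK => H1; case: ifPn; rewrite ?ltNge ?negbK => H2;
  move=> /andP[IH1 IH2]; try (case: ifPn; rewrite ?ltNge ?negbK => H4);
  try (case: ifPn; rewrite ?ltNge ?negbK => H5);
  apply/andP; split; lra.
Qed.

Lemma layers_pinfty (h : R) (N : nat) : layers h N +oo%E = N%:R * h.
Proof.
rewrite /layers (eq_bigr (fun=> h)); last by move=> i _; rewrite ltry mulr1.
by rewrite sumr_const card_ord mulr_natl.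
Qed.

Lemma layers_le (h : R) (N : nat) (x : \bar R) :
  0 <= h -> (0 <= x)%E -> ((layers h N x)%:E <= x)%E.
Proof.
case: x => [r| |]//; rewrite ?lee_fin => h0 r0; last exact: leey.
by have /andP[_] := layers_bounds N h0 r0; rewrite le_min => /andP[].
Qed.

(** A step of height [2h] at threshold [2(k+1)h] splits into two steps of height [h], at [(2k+1)h]
    and [(2k+2)h], neither of which has a higher threshold. *)
Lemma layers_half (h : R) (N : nat) (x : \bar R) : 0 <= h ->
  layers (2 * h) N x <= layers h (N * 2) x.
Proof.
move=> h0; elim: N => [|N IH]; first by rewrite /layers !big_ord0.
rewrite mulSn addnC addn2 !layersS -addrA lerD//.
rewrite -[leLHS]mulrA mulr_natl mulr2n; apply: lerD.
  rewrite ler_wpM2l// ler_nat; case: (ltP _ x) => //= H.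
  rewrite (le_lt_trans _ H)// lee_fin mulrA ler_wpM2r//.
  by rewrite -natrM ler_nat; lia.
rewrite ler_wpM2l// ler_nat mulrA -natrM; have -> // : (N.+1 * 2 = (N * 2).+2)%N by lia.
Qed.

Lemma layers_widen (h : R) (N M : nat) (x : \bar R) : 0 <= h ->
  (N <= M)%N -> layers h N x <= layers h M x.
Proof.
move=> h0 NM; rewrite /layers -(subnKC NM) big_split_ord/= lerDl.
by apply: sumr_ge0 => i _; rewrite mulr_ge0.
Qed.

(** Powers of two make successive thresholds nested. Monotonicity in [n] is what monotone
    convergence and the Fatou property call for. *)
Lemma layer_nondecreasing (x : \bar R) :
  {homo (fun n => layer n x) : n m / (n <= m)%N >-> n <= m}.
Proof.
apply: homo_leq => //; first by move=> ? ? ?; exact: le_trans.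
move=> n; rewrite /layer.
have -> : (2 ^- n = 2 * 2 ^- n.+1 :> R).
  by rewrite exprS invfM mulrA divff ?mul1r.
apply: (le_trans (layers_half _ _ _)); first by rewrite invr_ge0 exprn_ge0.
apply: layers_widen; first by rewrite invr_ge0 exprn_ge0.
by rewrite expnS; nia.
Qed.

Lemma layer_ge0 (n : nat) (x : \bar R) : 0 <= layer n x.
Proof.
by apply: sumr_ge0 => i _; rewrite mulr_ge0// invr_ge0 exprn_ge0.
Qed.

Lemma layer_le (n : nat) (x : \bar R) : (0 <= x)%E ->
  ((layer n x)%:E <= x)%E.
Proof. by apply: layers_le; rewrite invr_ge0 exprn_ge0. Qed.

Lemma layer_cvg (x : \bar R) : (0 <= x)%E ->
  (layer n x)%:E @[n --> \oo] --> x.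
Proof.
have hn (n : nat) : 0 <= 2 ^- n :> R by rewrite invr_ge0 exprn_ge0.
have nh (n : nat) : (n * 2 ^ n)%N%:R * 2 ^- n = n%:R :> R.
  by rewrite natrM natrX mulfK// expf_neq0.
case: x => [r| |]//; rewrite ?lee_fin => r0; last first.
  rewrite (_ : (fun n => _) = (fun n => (n%:R : R)%:E)).
    by apply/cvgeryP; exact: cvgr_idn.
  by apply/funext => n; rewrite /layer layers_pinfty nh.
apply: cvg_EFin; first exact: nearW.
apply: (@squeeze_cvgr _ _ _ _ (fun n => r - 2 ^- n) (fun=> r)).
- near=> n; have /andP[] := layers_bounds (n * 2 ^ n) (hn n) r0.
  rewrite -/(layer n r%:E) => H1; rewrite le_min => /andP[-> _]; rewrite andbT.
  apply: le_trans H1; rewrite lerD2r le_min lexx/= mulrSr mulrDl nh.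
  rewrite (@le_trans _ _ n%:R)//; last by rewrite lerDl mul1r.
  near: n; exact: nbhs_infty_ger.
- rewrite -[X in _ --> X]subr0; apply: cvgB; first exact: cvg_cst.
  rewrite (_ : (fun n => _) = (fun n => (2^-1) ^+ n)).
    by apply: cvg_expr; rewrite ger0_norm// invf_lt1// ltr1n.
  by apply/funext => n; rewrite exprVn.
- exact: cvg_cst.
Unshelve. all: by end_near. Qed.

(** * Distribution function and decreasing rearrangement *)

Lemma measurable_I01 : measurable (@I01 R).
Proof. exact: measurable_itv. Qed.
#[local] Hint Extern 0 (measurable _) => solve [exact: measurable_I01] : core.

Lemma I01E (x : R) : I01 x = (0 <= x <= 1) :> Prop.
Proof. by rewrite /I01/= in_itv. Qed.

Lemma lebesgue_I01 : lam I01 = 1%E.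
Proof. by rewrite /I01 lebesgue_measure_itv/= lte_fin ltr01 oppr0 adde0. Qed.

Lemma ae01W (P : R -> Prop) : (forall x, I01 x -> P x) -> ae01 P.
Proof.
move=> IP; exists (~` I01); split; first exact: measurableC.
  by rewrite /mu01 /mrestr setICl measure0.
by move=> x /= nPx Ix; apply/nPx/IP.
Qed.

Lemma ae01_lebesgue (P : R -> Prop) : ae01 P -> \forall x \ae lam, I01 x -> P x.
Proof.
move=> [A [mA A0 PA]]; exists (A `&` I01); split => //; first exact: measurableI.
by move=> x /= /not_implyP[Ix nPx]; split=> //; apply: PA.
Qed.

(** [mu01] puts no mass outside [[0, 1]], so an exceptional set may be enlarged by that
    complement. *)
Lemma ae01P (P : R -> Prop) : ae01 P <-> \forall x \ae lam, I01 x -> P x.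
Proof.
split; first exact: ae01_lebesgue.
move=> [A [mA A0 PA]]; exists (A `|` ~` I01); split.
- by apply: measurableU => //; exact: measurableC.
- rewrite /mu01 /mrestr setIUl setICl setU0; apply/eqP.
  rewrite eq_le measure_ge0 andbT -A0 le_measure ?inE//; exact: measurableI.
- move=> x /= nPx; have [Ix|nIx] := pselect (I01 x); [left|by right].
  by apply: PA => /= /(_ Ix).
Qed.

Lemma ae01S (P Q : R -> Prop) : (forall x, I01 x -> P x -> Q x) -> ae01 P -> ae01 Q.
Proof.
move=> PQ /ae01P[A [mA A0 PA]]; apply/ae01P; exists A; split=> // x /= /not_implyP[Ix nQ].
by apply: PA => /= /(_ Ix) Px; exact/nQ/PQ.
Qed.

Lemma Mplus_ge0 X x : Mplus X -> I01 x -> (0 <= X x)%E.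
Proof. by case=> _; apply. Qed.

Lemma measurable_superlevel X l : Mplus X -> measurable (I01 `&` [set x | (l%:E < X x)%E]).
Proof. by move=> [mX _]; exact: emeasurable_fun_o_infty. Qed.

Lemma distrE X l : Mplus X -> distr X l = lam (I01 `&` [set x | (l%:E < X x)%E]).
Proof.
move=> pX; congr (lam _); apply/seteqP; split=> x [Ix] /=;
  by rewrite gee0_abs//; exact: Mplus_ge0.
Qed.

Lemma distr_le1 X l : Mplus X -> (distr X l <= 1)%E.
Proof.
move=> pX; rewrite -lebesgue_I01 distrE//; apply: le_measure; rewrite ?inE//.
exact: measurable_superlevel.
Qed.

Lemma distr_ge0 X l : (0 <= distr X l)%E.
Proof. exact: measure_ge0. Qed.

Lemma distr_fin_num X l : Mplus X -> distr X l \is a fin_num.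
Proof.
by move=> pX; rewrite ge0_fin_numE ?distr_ge0// (le_lt_trans (distr_le1 _ _))// ltry.
Qed.

Lemma distr_lt0 X l : Mplus X -> l < 0 -> distr X l = 1%E.
Proof.
move=> pX l0; rewrite distrE// -lebesgue_I01; congr (lam _).
apply/seteqP; split=> x; first by case.
by move=> Ix; split=> //=; rewrite (lt_le_trans _ (Mplus_ge0 pX Ix))// lte_fin.
Qed.

Lemma distr_nonincreasing X l m : Mplus X -> l <= m -> (distr X m <= distr X l)%E.
Proof.
move=> pX lm; rewrite !distrE//; apply: le_measure; rewrite ?inE; try exact: measurable_superlevel.
by move=> x [Ix /= H]; split=> //=; apply: le_lt_trans H; rewrite lee_fin.
Qed.

Lemma le_distr X Y l : Mplus X -> Mplus Y -> ae01 (fun x => X x <= Y x)%E ->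
  (distr X l <= distr Y l)%E.
Proof.
move=> pX pY /ae01_lebesgue[A [mA A0 XYA]]; rewrite !distrE//.
rewrite -[leRHS]adde0 -[in leRHS]A0.
apply: le_trans (@measureU2 _ _ _ lam _ _ _ mA); last exact: measurable_superlevel.
apply: le_measure; rewrite ?inE; first exact: measurable_superlevel.
  by apply: measurableU => //; exact: measurable_superlevel.
move=> x [Ix /= lX]; have [|] := leP (X x) (Y x) => [XY|YX].
  by left; split=> //=; exact: lt_le_trans XY.
by right; apply: XYA => /= /(_ Ix); rewrite leNgt YX.
Qed.

(** The distribution function is right-continuous, which makes it and [Xstar] generalized inverses
    with strict inequalities on both sides. Most facts about rearrangements reduce through this
    equivalence to facts about superlevel sets. *)
Lemma lt_Xstar X l w : Mplus X -> 0 <= l ->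
  (l%:E < Xstar X w)%E = (w%:E < distr X l)%E.
Proof.
move=> pX l0; apply/idP/idP; apply: contraTT; rewrite -!leNgt => H.
  by apply: ereal_inf_lbound; exists l.
(* Right-continuity at [l]: the sets [{X > l + 1/(n+1)}] increase to [{X > l}], so a common bound on
   their measures passes to the union. *)
suff : forall n, (distr X (l + n.+1%:R^-1) <= w%:E)%E.
  move=> {}H; pose F n := I01 `&` [set x | ((l + n.+1%:R^-1)%:E < X x)%E].
  have FE : \bigcup_n F n = I01 `&` [set x | (l%:E < X x)%E].
    apply/seteqP; split=> [x [n _ [Ix /= lx]]|x [Ix /= lx]].
      by split=> //=; apply: lt_trans lx; rewrite lte_fin ltrDl invr_gt0.
    have [r /andP[lr rx]] : exists r : R, (l%:E < r%:E)%E && (r%:E <= X x)%E.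
      case: (X x) lx => [r| |]//; first by move=> lr; exists r; rewrite lr lexx.
      by move=> _; exists (l + 1); rewrite leey lte_fin ltrDl ltr01.
    have [n nr] := ltr_add_invr (lr : l < r).
    by exists n => //; split=> //=; apply: lt_le_trans rx; rewrite lte_fin; exact: nr.
  have mF n : measurable (F n) by exact: measurable_superlevel.
  have mUF : measurable (\bigcup_n F n) by apply: bigcup_measurable => n _; exact: mF.
  have ndF : {homo F : n m / (n <= m)%N >-> (n <= m)%O}.
    move=> n m nm; apply/subsetPset => x [Ix /= lx]; split=> //=.
    by apply: le_lt_trans lx; rewrite lee_fin lerD2l lef_pV2 ?posrE// ler_nat.
  have cF := nondecreasing_cvg_mu (mu := lam) mF mUF ndF.
  rewrite distrE// -FE -(cvg_lim _ cF)//.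
  apply: lime_le; first exact: cvgP cF.
  by apply: nearW => n /=; rewrite -distrE.
move=> n; rewrite leNgt; apply/negP => wd; move: H; apply/negP; rewrite -ltNge.
apply: (@lt_le_trans _ _ (l + n.+1%:R^-1)%:E); first by rewrite lte_fin ltrDl invr_gt0.
apply: le_ereal_inf_tmp => _ [m [m0 dm] <-]; rewrite lee_fin leNgt; apply/negP => ml.
move: wd; rewrite ltNge => /negP; apply; apply: le_trans dm.
by apply: distr_nonincreasing => //; exact: ltW.
Qed.

Lemma Xstar_ge0 X w : (0 <= Xstar X w)%E.
Proof. by apply: le_ereal_inf_tmp => _ [m [m0 _] <-]; rewrite lee_fin. Qed.

Lemma Xstar_nonincreasing X w v : w <= v -> (Xstar X v <= Xstar X w)%E.
Proof.
move=> wv; apply: ereal_inf_le_tmp => _ [m [m0 dm] <-]; exists m => //; split=> //.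
by apply: le_trans dm _; rewrite lee_fin.
Qed.

Lemma eq_Xstar X Y : equimeasurable X Y -> Xstar X = Xstar Y.
Proof.
move=> XY; apply/funext => w; rewrite /Xstar; congr (ereal_inf (_ @` _)).
by apply/funext => l/=; rewrite XY.
Qed.

Lemma le_Xstar X Y w : Mplus X -> Mplus Y -> ae01 (fun x => X x <= Y x)%E ->
  (Xstar X w <= Xstar Y w)%E.
Proof.
move=> pX pY XY; apply: ereal_inf_le_tmp => _ [m [m0 dm] <-]; exists m => //; split=> //.
by apply: le_trans dm; exact: le_distr.
Qed.

Lemma superlevel_Xstar X l : Mplus X -> 0 <= l ->
  I01 `&` [set w | (l%:E < Xstar X w)%E] = `[0, fine (distr X l)[%classic.
Proof.
move=> pX l0; apply/seteqP; split=> w /=; rewrite lt_Xstar// -(fineK (distr_fin_num l pX)) lte_fin;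
  rewrite I01E in_itv/=.
  by case=> /andP[-> _] ->.
move=> /andP[w0 wd]; rewrite w0; split=> //=; apply: (le_trans (ltW wd)).
by rewrite -lee_fin fineK ?distr_fin_num// distr_le1.
Qed.

Lemma Mplus_Xstar X : Mplus X -> Mplus (Xstar X).
Proof.
move=> pX; split; last by move=> x _; exact: Xstar_ge0.
apply: (measurability _ (ErealGenOInfty.measurableE R)).
move=> /= _ [_ [a ->]] <-; rewrite preimage_itvoy.
have [a0|a0] := leP 0 a; first by rewrite superlevel_Xstar.
rewrite (_ : _ `&` _ = I01)//; apply/seteqP; split=> x; first by case.
by move=> Ix; split=> //=; apply: lt_le_trans (Xstar_ge0 _ _); rewrite lte_fin.
Qed.

Lemma equimeasurable_Xstar X : Mplus X -> equimeasurable (Xstar X) X.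
Proof.
move=> pX l; have pXs := Mplus_Xstar pX.
have [l0|l0] := leP 0 l; last by rewrite !distr_lt0.
rewrite distrE// superlevel_Xstar// lebesgue_measure_itv/= lte_fin.
case: ifPn => [d0|]; first by rewrite oppr0 adde0 fineK// distr_fin_num.
rewrite -leNgt => d0; apply/eqP; rewrite eq_le distr_ge0/=.
by rewrite -[distr X l]fineK ?distr_fin_num// lee_fin.
Qed.

(** * Integrals of top quantiles *)

Lemma layer_indE X (n : nat) x : I01 x ->
  ((layer n (X x))%:E = \sum_(k < n * 2 ^ n)
     (2 ^- n)%:E * ind (I01 `&` [set y | ((k.+1)%:R * 2 ^- n)%:E < X y]) x)%E.
Proof.
move=> Ix; rewrite /layer /layers -sumEFin; apply: eq_bigr => k _.
rewrite EFinM /ind indicE in_setI (mem_set Ix)/=; congr (_ * (_%:R)%:E)%E.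
by apply: congr1; apply/esym; apply/idP/idP; rewrite inE.
Qed.

Lemma measurable_layer X (n : nat) : Mplus X ->
  measurable_fun I01 (fun x => (layer n (X x))%:E).
Proof.
move=> pX.
apply: (eq_measurable_fun (fun x => \sum_(k < n * 2 ^ n)
    (2 ^- n)%:E * ind (I01 `&` [set y | ((k.+1)%:R * 2 ^- n)%:E < X y]) x)%E).
  by move=> x; rewrite inE => Ix; rewrite layer_indE.
apply: emeasurable_sum => k; apply: emeasurable_funM; first exact: measurable_cst.
apply/measurable_EFinP; apply: measurable_indic; exact: measurable_superlevel.
Qed.

Lemma integral_layer X (n : nat) : Mplus X ->
  (\int[lam]_(x in I01) (layer n (X x))%:E =
   \sum_(k < n * 2 ^ n) (2 ^- n)%:E * distr X (k.+1%:R * 2 ^- n))%E.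
Proof.
move=> pX.
under eq_integral => x /[!inE] Ix do rewrite layer_indE//.
have h0 : (0 <= (2 ^- n : R)%:E)%E by rewrite lee_fin invr_ge0 exprn_ge0.
have mi (k : nat) : measurable_fun I01
    (ind (I01 `&` [set y | ((k.+1)%:R * 2 ^- n)%:E < X y])%E).
  by apply/measurable_EFinP/measurable_indic; exact: measurable_superlevel.
rewrite ge0_integral_sum//.
- apply: eq_bigr => k _; rewrite ge0_integralZl//; [|exact: mi|by move=> x _; rewrite lee_fin].
  rewrite integral_indic//; last exact: measurable_superlevel.
  by rewrite setIAC setIid distrE.
- by move=> k; apply: emeasurable_funM; [exact: measurable_cst|exact: mi].
- by move=> k x _; rewrite mule_ge0// lee_fin.
Qed.

Lemma cvg_integral_layer X : Mplus X ->
  (\int[lam]_(x in I01) (layer n (X x))%:E)%E @[n --> \oo] -->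
  (\int[lam]_(x in I01) X x)%E.
Proof.
move=> pX.
have -> : (\int[lam]_(x in I01) X x)%E =
    (\int[lam]_(x in I01) limn (fun n => (layer n (X x))%:E))%E.
  apply: eq_integral => x /[!inE] Ix; apply/esym/cvg_lim => //.
  by apply: layer_cvg; exact: Mplus_ge0.
apply: cvg_monotone_convergence => //.
- by move=> n; exact: measurable_layer.
- by move=> n x _; rewrite lee_fin layer_ge0.
- by move=> x _ n m nm; rewrite lee_fin layer_nondecreasing.
Qed.

(** Both integrals are limits of the same layer sums, which depend on the distribution function
    alone. *)
Lemma integral_equimeasurable X Y : Mplus X -> Mplus Y -> equimeasurable X Y ->
  (\int[lam]_(x in I01) X x = \int[lam]_(x in I01) Y x)%E.
Proof.
move=> pX pY XY.
rewrite -(cvg_lim _ (cvg_integral_layer pX))// -(cvg_lim _ (cvg_integral_layer pY))//.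
congr (limn _); apply/funext => n; rewrite !integral_layer//.
by apply: eq_bigr => k _; rewrite XY.
Qed.

Definition excess (l : R) X : R -> \bar R := fun x => maxe (X x - l%:E)%E 0%E.

Lemma excess_ge0 l X x : (0 <= excess l X x)%E.
Proof. by rewrite /excess le_max lexx orbT. Qed.

Lemma Mplus_excess l X : Mplus X -> Mplus (excess l X).
Proof.
move=> [mX _]; split; last by move=> x _; exact: excess_ge0.
apply: measurable_maxe; last exact: measurable_cst.
by apply: emeasurable_funB => //; exact: measurable_cst.
Qed.

Lemma equimeasurable_excess l X Y : 0 <= l -> Mplus X -> Mplus Y ->
  equimeasurable X Y -> equimeasurable (excess l X) (excess l Y).
Proof.
move=> l0 pX pY XY m; have [m0|m0] := leP 0 m; last first.
  by rewrite !distr_lt0//; exact: Mplus_excess.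
have E Z : Mplus Z -> distr (excess l Z) m = distr Z (m + l).
  move=> pZ; rewrite !distrE//; last exact: Mplus_excess.
  congr (lam (_ `&` _)); apply/seteqP; split=> x /=;
    by rewrite /excess lt_max EFinD lteBrDr// [(m%:E < 0)%E]ltNge lee_fin m0 orbF.
by rewrite !E.
Qed.

(** This is [K(t, X)], Peetre's K-functional of the couple of [L^1] and [L^oo]. *)
Definition top_integral X (t : R) : \bar R := (\int[lam]_(w in `[0%R, t]) Xstar X w)%E.

Lemma subset_I01 (t : R) : t <= 1 -> `[0, t]%classic `<=` I01.
Proof. by move=> t1; apply: subset_itvl; rewrite bnd_simp. Qed.

Lemma measurable_Xstar X (t : R) : Mplus X -> t <= 1 ->
  measurable_fun `[0, t] (Xstar X).
Proof.
move=> /Mplus_Xstar[mX _] t1; apply: measurable_funS mX => //; exact: subset_I01.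
Qed.

Lemma lebesgue_0itv (t : R) : 0 <= t -> lam `[0, t] = t%:E.
Proof.
move=> t0; rewrite lebesgue_measure_itv/= lte_fin; case: ltgtP t0 => //= [t0|<-] _ //.
by rewrite oppr0 adde0.
Qed.

Lemma integral_Xstar_excess X (t l : R) : Mplus X -> 0 <= l -> 0 <= t <= 1 ->
  (\int[lam]_(w in `[0%R, t]) (l%:E + excess l (Xstar X) w) =
   (l * t)%:E + \int[lam]_(w in `[0%R, t]) excess l (Xstar X) w)%E.
Proof.
move=> pX l0 /andP[t0 t1].
rewrite ge0_integralD//.
- by rewrite integral_cst// EFinM; congr (_ * _ + _)%E; exact: lebesgue_0itv.
- by move=> x _; exact: excess_ge0.
- have [mE _] := Mplus_excess l (Mplus_Xstar pX).
  by apply: measurable_funS mE => //; exact: subset_I01.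
Qed.

Lemma measurable_excess_Xstar X (t l : R) : Mplus X -> t <= 1 ->
  measurable_fun `[0, t] (excess l (Xstar X)).
Proof.
move=> pX t1; have [mE _] := Mplus_excess l (Mplus_Xstar pX).
by apply: measurable_funS mE => //; exact: subset_I01.
Qed.

(** On [[0, t]] the rearrangement is at most [l] plus its excess over [l]; the excess is then
    integrated over all of [[0, 1]], where equimeasurability brings back [X]. *)
Lemma top_integral_le X (t l : R) : Mplus X -> 0 <= l -> 0 <= t <= 1 ->
  (top_integral X t <= (l * t)%:E + \int[lam]_(x in I01) excess l X x)%E.
Proof.
move=> pX l0 t01; have /andP[t0 t1] := t01.
rewrite -(integral_equimeasurable (Mplus_excess l (Mplus_Xstar pX)) (Mplus_excess l pX)); last first.
  by apply: equimeasurable_excess => //; [exact: Mplus_Xstar|exact: equimeasurable_Xstar].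
apply: (@le_trans _ _ (\int[lam]_(w in `[0%R, t]) (l%:E + excess l (Xstar X) w))%E).
  apply: ge0_le_integral => //.
  - by move=> x _; exact: Xstar_ge0.
  - exact: measurable_Xstar.
  - apply: emeasurable_funD => //; exact: measurable_excess_Xstar.
  - move=> x _; rewrite /excess.
    have [H|H] := leP (Xstar X x - l%:E)%E 0%E.
      by rewrite adde0; rewrite leeBlDr// add0e in H.
    by rewrite addeC subeK.
rewrite integral_Xstar_excess// leeD2l//.
apply: ge0_subset_integral => //; last exact: subset_I01.
  by have [] := Mplus_excess l (Mplus_Xstar pX).
by move=> x _; exact: excess_ge0.
Qed.

(** At this level both losses in [top_integral_le] vanish: the rearrangement is at least [l] on
    [[0, t]], and its excess over [l] is zero beyond [t]. *)
Lemma top_integral_excess X (t l : R) : Mplus X -> 0 <= l -> 0 <= t <= 1 ->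
  Xstar X t = l%:E ->
  (top_integral X t = (l * t)%:E + \int[lam]_(x in I01) excess l X x)%E.
Proof.
move=> pX l0 t01 Xt; have /andP[t0 t1] := t01.
rewrite -(integral_equimeasurable (Mplus_excess l (Mplus_Xstar pX)) (Mplus_excess l pX)); last first.
  by apply: equimeasurable_excess => //; [exact: Mplus_Xstar|exact: equimeasurable_Xstar].
have -> : (\int[lam]_(x in I01) excess l (Xstar X) x =
           \int[lam]_(x in `[0%R, t]) excess l (Xstar X) x)%E.
  rewrite [RHS]integral_mkcond [LHS]integral_mkcond; apply: eq_integral => x _.
  rewrite !patchE; case: ifPn => [/[!inE] Ix|nIx]; last first.
    rewrite ifN//; apply: contra nIx; rewrite !inE; exact: subset_I01.
  have /andP[x0 x1] : 0 <= x <= 1 by rewrite -I01E.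
  case: ifPn => //; rewrite notin_setE/= in_itv/= x0/= => /negP; rewrite -ltNge => tx.
  apply/eqP; rewrite eq_le excess_ge0 andbT /excess ge_max lexx andbT leeBlDr// add0e.
  by rewrite -Xt Xstar_nonincreasing// ltW.
rewrite -integral_Xstar_excess//; apply: eq_integral => x /[!inE]/=.
rewrite in_itv/= => /andP[x0 xt].
rewrite /excess max_l; first by rewrite addeC subeK.
by rewrite leeBrDr// add0e -Xt Xstar_nonincreasing.
Qed.

(** * Rearrangements and top integrals under sums, multiples and monotone limits *)

Lemma eq_ereal_superlevel (x y : \bar R) : (0 <= x)%E -> (0 <= y)%E ->
  (forall l : R, 0 <= l -> (l%:E < x)%E = (l%:E < y)%E) -> x = y.
Proof.
move=> x0 y0 xy; apply/eqP; rewrite eq_le.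
have H (u v : \bar R) : (0 <= u)%E -> (forall l : R, 0 <= l -> (l%:E < u)%E = (l%:E < v)%E) ->
    (v <= u)%E.
  case: u => [r| |]// r0 uv; last exact: leey.
  by rewrite leNgt -uv ?ltxx// -lee_fin.
by apply/andP; split; apply: H => // l l0; rewrite xy.
Qed.

Lemma MplusD X Y : Mplus X -> Mplus Y -> Mplus (X \+ Y)%E.
Proof.
move=> [mX X0] [mY Y0]; split; first exact: emeasurable_funD.
by move=> x Ix; rewrite adde_ge0//; [exact: X0|exact: Y0].
Qed.

Lemma MplusZ (c : R) X : 0 <= c -> Mplus X -> Mplus (fun x => c%:E * X x)%E.
Proof.
move=> c0 [mX X0]; split; first by apply: emeasurable_funM => //; exact: measurable_cst.
by move=> x Ix; rewrite mule_ge0//; exact: X0.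
Qed.

Lemma Mplus_ind (E : set R) : measurable E -> Mplus (ind E).
Proof.
move=> mE; split; first exact/measurable_EFinP/measurable_indic.
by move=> x _; rewrite lee_fin.
Qed.

Lemma XstarZ (c : R) X w : 0 < c -> Mplus X ->
  Xstar (fun x => c%:E * X x)%E w = (c%:E * Xstar X w)%E.
Proof.
move=> c0 pX; have pcX := MplusZ (ltW c0) pX.
apply: eq_ereal_superlevel; rewrite ?mule_ge0 ?Xstar_ge0 ?lee_fin ?(ltW c0)// => l l0.
have cl (x : \bar R) : (l%:E < c%:E * x)%E = ((c^-1 * l)%:E < x)%E.
  by rewrite EFinM lte_pdivrMl.
rewrite cl !lt_Xstar// ?mulr_ge0// ?invr_ge0 ?(ltW c0)//; congr (_ < _)%E.
rewrite !distrE//; congr (lam (_ `&` _)).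
by apply/funext => x /=; rewrite cl.
Qed.

Lemma Xstar_ind (E : set R) w : measurable E -> E `<=` I01 -> 0 <= w ->
  Xstar (ind E) w = ind `[0, fine (lam E)[ w.
Proof.
move=> mE EI w0; have pE := Mplus_ind mE.
have fE : lam E \is a fin_num.
  rewrite ge0_fin_numE ?measure_ge0//; apply: (@le_lt_trans _ _ 1%E); last exact: ltry.
  by rewrite -lebesgue_I01; apply: le_measure; rewrite ?inE.
apply: eq_ereal_superlevel; rewrite ?Xstar_ge0// ?lee_fin// => l l0.
rewrite lt_Xstar// lte_fin indicE.
have -> : (w \in `[0, fine (lam E)[%classic) = (w%:E < lam E)%E.
  rewrite -[X in (_ < X)%E]fineK// lte_fin.
  by apply/idP/idP; rewrite inE/= in_itv/= w0.
have [l1|l1] := ltP l 1.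
  rewrite (_ : distr _ l = lam E); first by case: ltP; rewrite ?l1 ?ltNge ?l0.
  rewrite distrE//; congr (lam _); apply/seteqP; split=> x /=; rewrite /ind lte_fin indicE.
    by case=> _; case: (boolP (x \in E)) => [/[!inE]//|_]; rewrite ltNge l0.
  by move=> Ex; rewrite mem_set//; split=> //; exact: EI.
rewrite (_ : distr _ l = 0)%E; last first.
  rewrite distrE// (_ : _ `&` _ = set0) ?measure0//; apply/seteqP; split=> x //= [_].
  rewrite /ind lte_fin indicE; case: (_ \in _); rewrite ltNge => /negP; apply=> //.
rewrite lte_fin ltNge w0/=; apply/esym/negbTE; rewrite -leNgt.
by case: (_ < _)%E; rewrite // (le_trans _ l1).
Qed.

Lemma ae01_le_lim (Xn : nat -> R -> \bar R) X :
  ae01 (fun x => ({homo (fun n => Xn n x) : n m / (n <= m)%N >-> (n <= m)%E})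
                        /\ ((fun n => Xn n x) @ \oo --> X x)) ->
  forall n, ae01 (fun x => Xn n x <= X x)%E.
Proof.
move=> H n; apply: ae01S H => x _ [nd cX].
have cS := ereal_nondecreasing_cvgn nd.
rewrite -(cvg_lim _ cX)// (cvg_lim _ cS)//.
by apply: ereal_sup_ubound; exists n.
Qed.

(** Up to a null set, [{X > l}] is the increasing union of the sets [{X_n > l}], so the distribution
    functions increase to that of [X]; [lt_Xstar] carries this over to the rearrangements. *)
Lemma cvg_Xstar (Xn : nat -> R -> \bar R) X w : (forall n, Mplus (Xn n)) -> Mplus X ->
  ae01 (fun x => ({homo (fun n => Xn n x) : n m / (n <= m)%N >-> (n <= m)%E})
                        /\ ((fun n => Xn n x) @ \oo --> X x)) ->
  Xstar (Xn n) w @[n --> \oo] --> Xstar X w.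
Proof.
move=> pXn pX aX; have XnX := ae01_le_lim aX.
have nd : {homo (fun n => Xstar (Xn n) w) : n m / (n <= m)%N >-> (n <= m)%E}.
  by move=> n m nm; apply: le_Xstar => //; apply: ae01S aX => x _ [+ _]; apply.
suff -> : Xstar X w = ereal_sup (range (fun n => Xstar (Xn n) w)).
  exact: ereal_nondecreasing_cvgn.
set S := ereal_sup _; have S0 : (0 <= S)%E.
  by apply: (le_trans (Xstar_ge0 (Xn 0%N) w)); apply: ereal_sup_ubound; exists 0%N.
apply: eq_ereal_superlevel => // [|l l0]; first exact: Xstar_ge0.
apply/idP/idP; last first.
  move=> /ereal_sup_gt[_ [n _ <-]] lX; apply: (lt_le_trans lX).
  exact: le_Xstar.
apply: contraTT; rewrite -!leNgt => Sl.
rewrite leNgt lt_Xstar// -leNgt.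
have dn n : (distr (Xn n) l <= w%:E)%E.
  rewrite leNgt -lt_Xstar// -leNgt; apply: le_trans Sl.
  by apply: ereal_sup_ubound; exists n.
have [N [mN N0 PN]] := ae01_lebesgue aX.
(* Removing the exceptional set [N] makes the sets nested everywhere, as continuity of the measure
   from below requires. *)
pose F n := (I01 `&` [set x | (l%:E < Xn n x)%E]) `\` N.
have mS n : measurable (I01 `&` [set x | (l%:E < Xn n x)%E]).
  exact: measurable_superlevel.
have mF n : measurable (F n) by apply: measurableD.
have mUF : measurable (\bigcup_n F n) by apply: bigcup_measurable => n _; exact: mF.
have good x : I01 x -> ~ N x ->
    ({homo (fun n => Xn n x) : n m / (n <= m)%N >-> (n <= m)%E})
    /\ ((fun n => Xn n x) @ \oo --> X x).
  by move=> Ix nNx; apply: contrapT => H; apply: nNx; apply: PN => /= /(_ Ix).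
have ndF : {homo F : n m / (n <= m)%N >-> (n <= m)%O}.
  move=> n m nm; apply/subsetPset => x [[Ix /= lx] nNx]; split=> //; split=> //=.
  by apply: lt_le_trans lx _; have [+ _] := good _ Ix nNx; apply.
have cF := nondecreasing_cvg_mu (mu := lam) mF mUF ndF.
have UFw : (lam (\bigcup_n F n) <= w%:E)%E.
  rewrite -(cvg_lim _ cF)//; apply: lime_le; first exact: cvgP cF.
  apply: nearW => n /=; apply: le_trans (dn n); rewrite distrE//.
  by apply: le_measure; rewrite ?inE; [exact: mF|exact: mS|exact: subDsetl].
apply: le_trans UFw; rewrite distrE// -[leRHS]adde0 -[in leRHS]N0.
apply: le_trans (@measureU2 _ _ _ lam _ _ mUF mN).
apply: le_measure; rewrite ?inE; [exact: measurable_superlevel|exact: measurableU|].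
move=> x [Ix /= lx]; have [Nx|nNx] := pselect (N x); [by right|left].
have [ndx cx] := good _ Ix nNx.
move: lx; rewrite -(cvg_lim _ cx)// (cvg_lim _ (ereal_nondecreasing_cvgn ndx))//.
by move=> /ereal_sup_gt[_ [n _ <-]] lx; exists n.
Qed.

Lemma top_integral_ge0 X t : (0 <= top_integral X t)%E.
Proof. by apply: integral_ge0 => w _; exact: Xstar_ge0. Qed.
#[local] Hint Resolve top_integral_ge0 : core.

Lemma top_integral1 X : Mplus X -> (top_integral X 1 = \int[lam]_(x in I01) X x)%E.
Proof.
move=> pX; apply: integral_equimeasurable => //; first exact: Mplus_Xstar.
exact: equimeasurable_Xstar.
Qed.

(** Covers an infinite quantile, for which [top_integral_excess] has no real level to offer. *)
Lemma top_integral_pinfty X t : Mplus X -> 0 < t <= 1 -> Xstar X t = +oo%E ->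
  top_integral X t = +oo%E.
Proof.
move=> pX /andP[t0 t1] Xt; apply/eqP; rewrite -leye_eq.
apply: (@le_trans _ _ (\int[lam]_(w in `[0%R, t]) (cst +oo w))%E).
  rewrite integral_cst// gt0_mulye//.
  apply: (@lt_le_trans _ _ t%:E); first by rewrite lte_fin.
  rewrite -(lebesgue_0itv (ltW t0)); exact: lexx.
apply: ge0_le_integral; [exact: measurable_itv|by move=> x _; exact: leey| | |].
- exact: measurable_cst.
- exact: measurable_Xstar.
move=> x /=; rewrite in_itv/= => /andP[_ xt]; rewrite -Xt; exact: Xstar_nonincreasing.
Qed.

Lemma le_top_integral X Y t : Mplus X -> Mplus Y -> t <= 1 ->
  ae01 (fun x => X x <= Y x)%E -> (top_integral X t <= top_integral Y t)%E.
Proof.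
move=> pX pY t1 XY; apply: ge0_le_integral => //.
- by move=> x _; exact: Xstar_ge0.
- exact: measurable_Xstar.
- exact: measurable_Xstar.
- by move=> x _; exact: le_Xstar.
Qed.

Lemma top_integralZ (c : R) X t : 0 < c -> Mplus X -> t <= 1 ->
  (top_integral (fun x => c%:E * X x) t = c%:E * top_integral X t)%E.
Proof.
move=> c0 pX t1; rewrite /top_integral -ge0_integralZl//.
- by apply: eq_integral => w _; exact: XstarZ.
- exact: measurable_Xstar.
- by move=> x _; exact: Xstar_ge0.
- by rewrite lee_fin ltW.
Qed.

Lemma excessD_le (l m : R) X Y x : I01 x -> Mplus X -> Mplus Y ->
  (excess (l + m) (X \+ Y)%E x <= excess l X x + excess m Y x)%E.
Proof.
move=> Ix pX pY; rewrite /excess ge_max; apply/andP; split; last first.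
  by rewrite adde_ge0// le_max lexx orbT.
apply: (@le_trans _ _ ((X x - l%:E) + (Y x - m%:E))%E).
  by rewrite EFinD fin_num_oppeD// addeACA.
by apply: leeD; rewrite le_max lexx.
Qed.

(** The levels [l] and [m] are optimal for [X] and [Y] separately; [l + m] may not be optimal for
    the sum but still gives an upper bound, and positive parts are subadditive. *)
Lemma top_integralD_le X Y t : Mplus X -> Mplus Y -> 0 < t <= 1 ->
  (top_integral (X \+ Y)%E t <= top_integral X t + top_integral Y t)%E.
Proof.
move=> pX pY t01; have /andP[t0 t1] := t01.
have t01' : 0 <= t <= 1 by rewrite ltW.
have := Xstar_ge0 X t; case EX : (Xstar X t) => [l| |]// l0; last first.
  by rewrite (top_integral_pinfty pX)// addye ?leey// gt_eqF// (lt_le_trans _ (top_integral_ge0 _ _))// ltNy0.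
have := Xstar_ge0 Y t; case EY : (Xstar Y t) => [m| |]// m0; last first.
  by rewrite (top_integral_pinfty pY)// addey ?leey// gt_eqF// (lt_le_trans _ (top_integral_ge0 _ _))// ltNy0.
rewrite !lee_fin in l0 m0.
rewrite (top_integral_excess pX l0 t01' EX) (top_integral_excess pY m0 t01' EY).
apply: (le_trans (top_integral_le (MplusD pX pY) (addr_ge0 l0 m0) t01')).
rewrite mulrDl EFinD [leRHS]addeACA.
rewrite leeD2l// -ge0_integralD//.
- apply: ge0_le_integral => //.
  + by move=> x _; exact: excess_ge0.
  + by have [] := Mplus_excess (l + m) (MplusD pX pY).
  + apply: emeasurable_funD; first by have [] := Mplus_excess l pX.
    by have [] := Mplus_excess m pY.
  + by move=> x Ix; exact: excessD_le.
- by move=> x _; exact: excess_ge0.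
- by have [] := Mplus_excess l pX.
- by move=> x _; exact: excess_ge0.
- by have [] := Mplus_excess m pY.
Qed.

Lemma cvg_top_integral (Xn : nat -> R -> \bar R) X t : t <= 1 ->
  (forall n, Mplus (Xn n)) -> Mplus X ->
  ae01 (fun x => ({homo (fun n => Xn n x) : n m / (n <= m)%N >-> (n <= m)%E})
                        /\ ((fun n => Xn n x) @ \oo --> X x)) ->
  top_integral (Xn n) t @[n --> \oo] --> top_integral X t.
Proof.
move=> t1 pXn pX aX.
have -> : top_integral X t =
    (\int[lam]_(x in `[0%R, t]) limn (fun n => Xstar (Xn n) x))%E.
  by apply: eq_integral => x _; apply/esym/cvg_lim => //; exact: cvg_Xstar.
apply: cvg_monotone_convergence => //.
- by move=> n; exact: measurable_Xstar.
- by move=> n x _; exact: Xstar_ge0.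
- by move=> x _ n m nm; apply: le_Xstar => //; apply: ae01S aX => y _ [+ _]; apply.
Qed.

Lemma lebesgue_sub_I01 (E : set R) : measurable E -> E `<=` I01 ->
  lam E \is a fin_num /\ 0 <= fine (lam E) <= 1.
Proof.
move=> mE EI; have E1 : (lam E <= 1)%E.
  by rewrite -lebesgue_I01; apply: le_measure; rewrite ?inE.
have fE : lam E \is a fin_num.
  by rewrite ge0_fin_numE ?measure_ge0// (le_lt_trans E1)// ltry.
by rewrite fine_ge0 ?measure_ge0//= -lee_fin fineK.
Qed.

Lemma lebesgue_0ito t : 0 <= t -> lam `[0, t[ = t%:E.
Proof.
move=> t0; rewrite lebesgue_measure_itv/= lte_fin; case: ltgtP t0 => //= [t0|<-] _ //.
by rewrite oppr0 adde0.
Qed.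

Lemma top_integral_ind (E : set R) t : measurable E -> E `<=` I01 -> 0 <= t <= 1 ->
  top_integral (ind E) t = (Num.min t (fine (lam E)))%:E.
Proof.
move=> mE EI /andP[t0 t1]; have [fE /andP[e0 e1]] := lebesgue_sub_I01 mE EI.
transitivity (\int[lam]_(w in `[0%R, t]) (ind `[0%R, fine (lam E)[ w))%E.
  by apply: eq_integral => w; rewrite inE/= in_itv/= => /andP[w0 _]; rewrite Xstar_ind.
rewrite integral_indic//; set e := fine _ in e0 e1 *.
have [te|et] := ltP t e.
  rewrite (_ : _ `&` _ = `[0, t]%classic); first exact: lebesgue_0itv.
  apply/seteqP; split=> x /=; rewrite !in_itv/=; first by case.
  by move=> /andP[x0 xt]; rewrite x0 xt (le_lt_trans xt te).
rewrite (_ : _ `&` _ = `[0, e[%classic).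
  exact: lebesgue_0ito.
apply/seteqP; split=> x /=; rewrite !in_itv/=; first by case.
by move=> /andP[x0 xe]; rewrite x0 xe (ltW (lt_le_trans xe et)).
Qed.

(** * Monotonicity and star-shapedness of concave functions *)

Lemma concave01_nondecreasing phi (u v : R) : concave_on01 phi -> phi 1 = 1 ->
  (forall t, I01 t -> 0 <= phi t <= 1) -> 0 <= u -> u <= v -> v <= 1 -> phi u <= phi v.
Proof.
move=> cphi phi1 rphi u0 uv v1.
have Iu : I01 u by rewrite I01E u0 (le_trans uv).
have [u1|u1] := eqVneq u 1; first by have -> : u = v by lra.
have {}u1 : u < 1 by rewrite lt_neqAle u1 (le_trans uv v1).
have d0 : 0 < 1 - u by rewrite subr_gt0.
have I1 : I01 (1 : R) by rewrite I01E lexx ler01.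
have t01 : 0 <= (1 - v) / (1 - u) <= 1.
  by rewrite divr_ge0 ?subr_ge0 ?(ltW u1)//= ler_pdivrMr// mul1r lerD2l lerN2.
have := cphi u 1 _ Iu I1 t01; rewrite phi1 mulr1.
have -> : (1 - v) / (1 - u) * u + (1 - (1 - v) / (1 - u)) = v by field; rewrite gt_eqF.
apply: le_trans; have /andP[_ pu] := rphi u Iu; have /andP[t0 t1] := t01.
nra.
Qed.

(** Concavity between [0] and [v]; in other words [phi(u) / u] is nonincreasing. *)
Lemma concave01_star phi (u v : R) : concave_on01 phi -> phi 0 = 0 ->
  0 <= u -> u <= v -> 0 < v -> v <= 1 -> u / v * phi v <= phi u.
Proof.
move=> cphi phi0 u0 uv v0 v1.
have Iv : I01 v by rewrite I01E ltW.
have I0 : I01 (0 : R) by rewrite I01E lexx ler01.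
have t01 : 0 <= u / v <= 1 by rewrite divr_ge0 ?(ltW v0)//= ler_pdivrMr// mul1r.
have := cphi v 0 _ Iv I0 t01; rewrite phi0 !mulr0 !addr0.
by rewrite divfK// gt_eqF.
Qed.

(** * The ri norm generated by the minorants of phi *)

(** The left side of the last condition is the fundamental function of the matching [piece], because
    [K(t, 1_E) = min(t, mu(E))]. *)
Definition admissible phi (p : R * R * R) : Prop := let: (a, b, t) := p in
  [/\ 0 <= a, 0 <= b, 0 < t <= 1 &
      forall u, I01 u -> a * Num.min t u + b * u <= phi u].

Definition piece X (p : R * R * R) : \bar R := let: (a, b, t) := p in
  (a%:E * top_integral X t + b%:E * top_integral X 1)%E.

(** Each [piece] is the Lorentz norm of its own minorant. Their supremum inherits subadditivity and
    the Fatou property without any integral against the derivative of [phi]. *)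
Definition sup_norm phi X : \bar R := ereal_sup (piece X @` admissible phi).

Lemma piece_le X phi p : admissible phi p -> (piece X p <= sup_norm phi X)%E.
Proof. by move=> ap; apply: ereal_sup_ubound; exists p. Qed.

Lemma piece_ge0 X phi p : admissible phi p -> (0 <= piece X p)%E.
Proof. by case: p => -[a b] t [a0 b0 _ _]; rewrite /= adde_ge0// mule_ge0. Qed.

(** This minorant is the chord [u]. Its piece is the integral of [X], which provides definiteness
    and the integrability axiom of the supremum. *)
Lemma admissible_integral phi : concave_on01 phi -> phi 0 = 0 -> phi 1 = 1 ->
  admissible phi (0, 1, 1).
Proof.
move=> cphi phi0 phi1; split=> //; first by rewrite ltr01 lexx.
move=> u; rewrite I01E mul0r add0r mul1r => /andP[u0 u1].
by have := concave01_star cphi phi0 u0 u1 ltr01 (lexx _); rewrite divr1 phi1 mulr1.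
Qed.

(** This minorant touches [phi] at [t], which makes [phi] the exact fundamental function of the
    supremum. Its piece is the term at [t] of the Marcinkiewicz norm. *)
Lemma admissible_marcinkiewicz phi t : concave_on01 phi -> phi 0 = 0 -> phi 1 = 1 ->
  (forall t, I01 t -> 0 <= phi t <= 1) -> 0 < t <= 1 -> admissible phi (phi t / t, 0, t).
Proof.
move=> cphi phi0 phi1 rphi /andP[t0 t1].
have It : I01 t by rewrite I01E ltW.
have /andP[pt0 pt1] := rphi t It; split=> //; first by rewrite divr_ge0// ltW.
  by rewrite t0.
move=> u; rewrite I01E mul0r addr0 => /andP[u0 u1]; rewrite minElt; case: ltP => tu.
  by rewrite divfK ?gt_eqF// concave01_nondecreasing// ltW.
by rewrite mulrC mulrA mulrAC; exact: concave01_star.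
Qed.

Lemma le_piece X Y phi p : admissible phi p -> Mplus X -> Mplus Y ->
  ae01 (fun x => X x <= Y x)%E -> (piece X p <= piece Y p)%E.
Proof.
case: p => -[a b] t [a0 b0 /andP[t0 t1] _] pX pY XY /=.
by apply: leeD; apply: lee_wpmul2l; rewrite ?lee_fin//; exact: le_top_integral.
Qed.

Lemma le_sup_norm phi X Y : Mplus X -> Mplus Y ->
  ae01 (fun x => X x <= Y x)%E -> (sup_norm phi X <= sup_norm phi Y)%E.
Proof.
move=> pX pY XY; apply: ge_ereal_sup => _ [p ap <-].
by apply: le_trans (piece_le Y ap); exact: (le_piece ap).
Qed.

Lemma sup_normD_le phi X Y : Mplus X -> Mplus Y ->
  (sup_norm phi (X \+ Y) <= sup_norm phi X + sup_norm phi Y)%E.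
Proof.
move=> pX pY; apply: ge_ereal_sup => _ [p ap <-].
apply: le_trans (leeD (piece_le X ap) (piece_le Y ap)).
case: p ap => -[a b] t [a0 b0 t01 _] /=.
have one01 : 0 < (1 : R) <= 1 by rewrite ltr01 lexx.
rewrite [leRHS]addeACA -!ge0_muleDr//; try exact: top_integral_ge0.
by apply: leeD; apply: lee_wpmul2l; rewrite ?lee_fin//; exact: top_integralD_le.
Qed.

Lemma sup_normZ_pos phi (c : R) X : 0 < c -> Mplus X ->
  (sup_norm phi (fun x => c%:E * X x) <= c%:E * sup_norm phi X)%E.
Proof.
move=> c0 pX; apply: ge_ereal_sup => _ [p ap <-].
apply: le_trans (lee_wpmul2l _ (piece_le X ap)); last by rewrite lee_fin ltW.
case: p ap => -[a b] t [a0 b0 /andP[t0 t1] _] /=.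
rewrite !top_integralZ//; have := top_integral_ge0 X t; have := top_integral_ge0 X 1.
move: (top_integral X 1) (top_integral X t) => A B A0 B0.
by rewrite ge0_muleDr ?mule_ge0 ?lee_fin// !(muleCA c%:E).
Qed.

Section sup_norm.
Variable phi : R -> R.
Hypothesis cphi : concave_on01 phi.
Hypothesis rphi : forall t, I01 t -> 0 <= phi t <= 1.
Hypothesis phi0 : phi 0 = 0.
Hypothesis phi1 : phi 1 = 1.

Lemma integral_le_sup_norm X : Mplus X -> (\int[lam]_(x in I01) X x <= sup_norm phi X)%E.
Proof.
move=> pX; have := piece_le X (admissible_integral cphi phi0 phi1).
by rewrite /= mul0e add0e mul1e top_integral1.
Qed.

Lemma sup_norm_ge0 X : (0 <= sup_norm phi X)%E.
Proof.
have ap := admissible_integral cphi phi0 phi1.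
exact: le_trans (piece_ge0 X ap) (piece_le X ap).
Qed.

Lemma sup_norm_ae0 X : Mplus X -> ae01 (fun x => X x = 0%E) -> sup_norm phi X = 0%E.
Proof.
move=> pX X0; apply/eqP; rewrite eq_le sup_norm_ge0 andbT.
apply: ge_ereal_sup => _ [p ap <-].
have p0 : Mplus (cst 0%E : R -> \bar R) by split=> //; exact: measurable_cst.
have e : piece (cst 0%E) p = 0%E.
  case: p ap => -[a b] t [a0 b0 /andP[t0 t1] _] /=.
  suff z s : s <= 1 -> top_integral (cst 0%E) s = 0%E :> \bar R by rewrite !z// !mule0 adde0.
  move=> s1; apply/eqP; rewrite eq_le top_integral_ge0 andbT.
  apply: (@le_trans _ _ (top_integral (cst 0%E : R -> \bar R) 1)).
    apply: ge0_subset_integral => //.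
    - exact: measurable_Xstar.
    - by move=> x _; exact: Xstar_ge0.
    - exact: subset_I01.
  by rewrite top_integral1// integral0.
by rewrite -e; apply: (le_piece ap) => //; apply: ae01S X0 => x _ ->.
Qed.

Lemma sup_norm_eq0 X : Mplus X -> (sup_norm phi X = 0%E <-> ae01 (fun x => X x = 0%E)).
Proof.
move=> pX; split; last exact: sup_norm_ae0.
move=> X0; apply/ae01P; apply/(ae_eq_integral_abs lam measurable_I01 (proj1 pX)).
apply/eqP; rewrite eq_le integral_ge0// andbT -X0.
apply: le_trans (integral_le_sup_norm pX).
by under eq_integral => x /[!inE] Ix do rewrite gee0_abs ?(Mplus_ge0 pX)//.
Qed.

Lemma sup_normZ (c : R) X : Mplus X -> 0 <= c ->
  (sup_norm phi (fun x => c%:E * X x) = c%:E * sup_norm phi X)%E.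
Proof.
move=> pX; rewrite le_eqVlt => /predU1P[<-|c0].
  rewrite mul0e; apply: sup_norm_ae0; first exact: MplusZ.
  by apply: ae01W => x _; rewrite mul0e.
apply/eqP; rewrite eq_le sup_normZ_pos//=.
have pcX := MplusZ (ltW c0) pX.
(* The opposite inequality is the one already proved, applied with [c^-1] to [c X]. *)
have ci : 0 < c^-1 by rewrite invr_gt0.
have := sup_normZ_pos phi ci pcX.
rewrite (_ : (fun x => _) = X); last first.
  by apply/funext => x; rewrite muleA -EFinM mulVf ?gt_eqF// mul1e.
by rewrite lee_pdivlMl.
Qed.

(** Every single piece converges along the sequence, and two suprema, over pieces and over [n], may
    be exchanged. *)
Lemma sup_norm_fatou (Xn : nat -> R -> \bar R) X : (forall n, Mplus (Xn n)) -> Mplus X ->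
  ae01 (fun x => ({homo (fun n => Xn n x) : n m / (n <= m)%N >-> (n <= m)%E})
                        /\ ((fun n => Xn n x) @ \oo --> X x)) ->
  ((fun n => sup_norm phi (Xn n)) @ \oo --> sup_norm phi X).
Proof.
move=> pXn pX aX.
have nd : {homo (fun n => sup_norm phi (Xn n)) : n m / (n <= m)%N >-> (n <= m)%E}.
  by move=> n m nm; apply: le_sup_norm => //; apply: ae01S aX => x _ [+ _]; apply.
suff -> : sup_norm phi X = ereal_sup (range (fun n => sup_norm phi (Xn n))).
  exact: ereal_nondecreasing_cvgn.
apply/eqP; rewrite eq_le; apply/andP; split; last first.
  by apply: ge_ereal_sup => _ [n _ <-]; apply: le_sup_norm => //; exact: ae01_le_lim.
apply: ge_ereal_sup => _ [p ap <-].
have cp : piece (Xn n) p @[n --> \oo] --> piece X p.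
  case: p ap => -[a b] t [a0 b0 /andP[t0 t1] _].
  have c (s r : R) : s <= 1 ->
      (r%:E * top_integral (Xn n) s)%E @[n --> \oo] --> (r%:E * top_integral X s)%E.
    by move=> s1; apply: cvgeZl => //; exact: cvg_top_integral.
  apply: cvgeD; [|exact: c|exact: c].
  by rewrite ge0_adde_def// inE mule_ge0//; exact: top_integral_ge0.
rewrite -(cvg_lim _ cp)//; apply: lime_le; first exact: cvgP cp.
apply: nearW => n; apply: (le_trans (piece_le _ ap)).
by apply: ereal_sup_ubound; exists n.
Qed.

Lemma sup_norm_fundamental : has_fundamental_function (sup_norm phi) phi.
Proof.
move=> E mE EI; have [fE e01] := lebesgue_sub_I01 mE EI.
have /andP[e0 e1] := e01.
have one01 : 0 <= (1 : R) <= 1 by rewrite ler01 lexx.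
apply/eqP; rewrite eq_le; apply/andP; split.
  apply: ge_ereal_sup => _ [[[a b] t] [a0 b0 /andP[t0 t1] ab] <-] /=.
  rewrite !top_integral_ind// ?(ltW t0)// (min_r e1) -!EFinM -EFinD lee_fin.
  by apply: ab; rewrite I01E.
have [->|en0] := eqVneq (fine (lam E)) 0; first by rewrite phi0 sup_norm_ge0.
have e01' : 0 < fine (lam E) <= 1 by rewrite lt0r en0 e0.
have := piece_le (ind E) (admissible_marcinkiewicz cphi phi0 phi1 rphi e01').
by rewrite /= mul0e adde0 top_integral_ind// minxx -EFinM divfK// gt_eqF.
Qed.

Lemma ri_sup_norm : ri_function_norm (sup_norm phi).
Proof.
split; last first.
  move=> X Y pX pY XY; rewrite /sup_norm; congr (ereal_sup (_ @` _)).
  by apply/funext => -[[a b] t]; rewrite /= /top_integral (eq_Xstar XY).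
split; first exact: sup_norm_eq0.
split; first by move=> X c pX c0; exact: sup_normZ.
split; first by move=> X Y; exact: sup_normD_le.
split; first by move=> X Y; exact: le_sup_norm.
split; first exact: sup_norm_fatou.
split.
  move=> E mE EI; rewrite sup_norm_fundamental// ltry; split=> //.
  exists 1 => X pX; rewrite mul1e; apply: le_trans (integral_le_sup_norm pX).
  apply: ge0_subset_integral => //; first exact: (proj1 pX).
  by move=> x; exact: Mplus_ge0.
by rewrite sup_norm_fundamental// lebesgue_I01 phi1.
Qed.

End sup_norm.

(** * Bounds for an arbitrary norm with fundamental function phi *)

Lemma norm_sum_le (Rn : (R -> \bar R) -> \bar R) (N : nat) (f : nat -> R -> \bar R) :
  banach_function_norm Rn -> (forall k, Mplus (f k)) ->
  (Rn (fun x => \sum_(k < N) f k x) <= \sum_(k < N) Rn (f k))%E.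
Proof.
move=> [R0 [RZ [RD _]]] pf.
have pS n : Mplus (fun x => \sum_(k < n) f k x)%E.
  split; first by apply: emeasurable_sum => k; have [] := pf k.
  by move=> x Ix; apply: sume_ge0 => k _; exact: Mplus_ge0.
elim: N => [|N IH].
  rewrite big_ord0; have [_ H] := R0 _ (pS 0%N); rewrite H//.
  by apply: ae01W => x _; rewrite big_ord0.
rewrite big_ord_recr/=; apply: le_trans (leeD IH (lexx _)).
rewrite (_ : (fun x => _) = ((fun x => \sum_(k < N) f k x) \+ f N)%E).
  exact: RD.
by apply/funext => x; rewrite big_ord_recr.
Qed.

(** The bound holds for indicators since [phi(mu(E)) <= c mu(E)]. Subadditivity over the layers
    extends it to layer sums, and the Fatou property to [Z]. *)
Lemma norm_le_integral (Rn : (R -> \bar R) -> \bar R) phi (c : R) Z :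
  banach_function_norm Rn -> has_fundamental_function Rn phi ->
  0 <= c -> (forall u, I01 u -> phi u <= c * u) -> Mplus Z ->
  (Rn Z <= c%:E * \int[lam]_(x in I01) Z x)%E.
Proof.
move=> bR fR c0 phic pZ; have [_ [RZ [_ [_ [RF _]]]]] := bR.
pose E n (k : nat) := I01 `&` [set x | ((k.+1)%:R * 2 ^- n)%:E < Z x]%E.
have mE n k : measurable (E n k) by exact: measurable_superlevel.
pose f n (k : nat) : R -> \bar R := fun x => ((2 ^- n)%:E * ind (E n k) x)%E.
have h0 n : 0 <= 2 ^- n :> R by rewrite invr_ge0 exprn_ge0.
have pf n k : Mplus (f n k) by apply: MplusZ => //; exact: Mplus_ind.
pose Zn n : R -> \bar R := fun x => (\sum_(k < n * 2 ^ n) f n k x)%E.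
have ZnE n x : I01 x -> Zn n x = (layer n (Z x))%:E by move=> Ix; rewrite layer_indE.
have pZn n : Mplus (Zn n).
  split; first by apply: emeasurable_sum => k; have [] := pf n k.
  by move=> x Ix; rewrite ZnE// lee_fin layer_ge0.
have cR := RF Zn Z pZn pZ.
rewrite -(cvg_lim _ (cR _))//; last first.
  apply: ae01W => x Ix; split.
    by move=> n m nm; rewrite !ZnE// lee_fin layer_nondecreasing.
  rewrite (_ : (fun n => _) = (fun n => (layer n (Z x))%:E)).
    by apply: layer_cvg; exact: Mplus_ge0.
  by apply/funext => n; rewrite ZnE.
have bound n : (Rn (Zn n) <= c%:E * \int[lam]_(x in I01) Z x)%E.
  apply: (le_trans (norm_sum_le _ bR (pf n))).
  apply: (@le_trans _ _ (c%:E * \int[lam]_(x in I01) (layer n (Z x))%:E)%E).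
    rewrite integral_layer// ge0_sume_distrr; last by move=> k _; rewrite mule_ge0 ?distr_ge0 ?lee_fin.
    apply: lee_sum => k _; rewrite RZ//; last exact: Mplus_ind.
    rewrite muleCA; apply: lee_wpmul2l; first by rewrite lee_fin.
    have EI : E n k `<=` I01 by move=> x [].
    have [fE e01] := lebesgue_sub_I01 (mE n k) EI.
    by rewrite fR// distrE// -[X in (_ * X)%E]fineK// -EFinM lee_fin phic// I01E.
  apply: lee_wpmul2l; first by rewrite lee_fin.
  apply: ge0_le_integral => //.
  - by move=> x _; rewrite lee_fin layer_ge0.
  - exact: measurable_layer.
  - exact: (proj1 pZ).
  - by move=> x Ix; apply: layer_le; exact: Mplus_ge0.
apply: lime_le; last exact: nearW.
apply/cvg_ex; exists (Rn Z); apply: cR.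
apply: ae01W => x Ix; split.
  by move=> n m nm; rewrite !ZnE// lee_fin layer_nondecreasing.
rewrite (_ : (fun n => _) = (fun n => (layer n (Z x))%:E)).
  by apply: layer_cvg; exact: Mplus_ge0.
by apply/funext => n; rewrite ZnE.
Qed.

Lemma norm_le_cst (Rn : (R -> \bar R) -> \bar R) X l :
  banach_function_norm Rn -> Mplus X -> 0 <= l -> ae01 (fun x => X x <= l%:E)%E ->
  (Rn X <= l%:E)%E.
Proof.
move=> [_ [RZ [_ [RM [_ [_ R1]]]]]] pX l0 Xl.
have pI : Mplus (ind (@I01 R)) by exact: Mplus_ind.
rewrite -[leRHS]mule1 -R1 -RZ//; apply: RM => //; first exact: MplusZ.
by apply: ae01S Xl => x Ix; rewrite /ind indicE mem_set// mule1.
Qed.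

Lemma Mplus_mine X l : Mplus X -> 0 <= l -> Mplus (fun x => mine (X x) l%:E).
Proof.
move=> pX l0; split; first by apply: measurable_mine; [exact: (proj1 pX)|exact: measurable_cst].
by move=> x Ix; rewrite le_min (Mplus_ge0 pX Ix) lee_fin.
Qed.

(** With [l] the quantile at [b], the truncation costs at most [l] by normalisation and the excess
    at most its integral over [b]; by [top_integral_excess] these add up to exactly
    [K(b, X) / b]. *)
Lemma norm_le_top_integral (Rn : (R -> \bar R) -> \bar R) phi (b : R) X :
  banach_function_norm Rn -> has_fundamental_function Rn phi ->
  0 < b <= 1 -> (forall u, I01 u -> phi u <= b^-1 * u) -> Mplus X ->
  (Rn X <= (b^-1)%:E * top_integral X b)%E.
Proof.
move=> bR fR b01 phib pX; have /andP[b0 b1] := b01.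
have b01' : 0 <= b <= 1 by rewrite ltW.
have bi0 : 0 < b^-1 by rewrite invr_gt0.
have := Xstar_ge0 X b; case EX : (Xstar X b) => [l| |]// l0; last first.
  by rewrite (top_integral_pinfty pX b01 EX) gt0_muley ?lte_fin// leey.
rewrite lee_fin in l0; rewrite (top_integral_excess pX l0 b01' EX).
rewrite ge0_muleDr ?lee_fin ?mulr_ge0 ?(ltW b0)//; last by apply: integral_ge0 => x _; exact: excess_ge0.
rewrite -EFinM mulrCA mulVf ?gt_eqF// mulr1.
have pm := Mplus_mine pX l0; have pe := Mplus_excess l pX.
have [_ [_ [RD [RM _]]]] := bR.
apply: (@le_trans _ _ (Rn ((fun x => mine (X x) l%:E) \+ excess l X)%E)).
  apply: RM => //; first exact: MplusD.
  apply: ae01W => x Ix; rewrite /excess /=.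
  have [H|H] := leP (X x) l%:E; first by rewrite leeDl// le_max lexx orbT.
  rewrite EFinN max_l; first by rewrite addeCA subee ?adde0.
  by rewrite leeBrDr// add0e ltW.
apply: le_trans (RD _ _ pm pe) _; apply: leeD.
  by apply: norm_le_cst => //; apply: ae01W => x _; rewrite ge_min lexx orbT.
by apply: (norm_le_integral bR fR); rewrite ?ltW.
Qed.

(** Reduces the lower bound below to truncated functions, for which the complement under a constant
    is well defined. *)
Lemma cvg_integral_mine (D : set R) X : measurable D -> measurable_fun D X ->
  (forall x, D x -> 0 <= X x)%E ->
  (\int[lam]_(x in D) mine (X x) (n%:R)%:E)%E @[n --> \oo] --> (\int[lam]_(x in D) X x)%E.
Proof.
move=> mD mX X0.
have nd x : D x -> {homo (fun n => mine (X x) (n%:R)%:E) : n m / (n <= m)%N >-> (n <= m)%E}.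
  by move=> _ n m nm; rewrite le_min2// lee_fin ler_nat.
have -> : (\int[lam]_(x in D) X x = \int[lam]_(x in D) limn (fun n => mine (X x) (n%:R)%:E))%E.
  apply: eq_integral => x /[!inE] Dx; apply/esym.
  rewrite (cvg_lim _ (ereal_nondecreasing_cvgn (nd _ Dx)))//.
  apply/eqP; rewrite eq_le; apply/andP; split.
    by apply: ge_ereal_sup => _ [n _ <-]; rewrite ge_min lexx.
  have := X0 _ Dx; case: (X x) => [r| |]//; rewrite ?lee_fin => r0.
    apply: ereal_sup_ubound; exists (Num.bound r) => //.
    by rewrite min_l// lee_fin ltW// archi_boundP.
  rewrite leye_eq; apply/eqP/eqyP => A A0.
  apply: (@le_trans _ _ ((Num.bound A)%:R)%:E); first by rewrite lee_fin ltW// archi_boundP// ltW.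
  by apply: ereal_sup_ubound; exists (Num.bound A) => //; rewrite min_r// leey.
apply: cvg_monotone_convergence => //.
- by move=> n; apply: measurable_mine => //; exact: measurable_cst.
- by move=> n x Dx; rewrite le_min X0//= lee_fin.
Qed.

(* Lower bounds come from the upper bound [norm_le_integral] applied to the complementary function
   [(M - min(X^*, M)) 1_[0, b]], because the norm of [M 1_[0, b]] is exactly [M]. *)
Lemma top_integral_le_norm (Rn : (R -> \bar R) -> \bar R) phi (b : R) X :
  ri_function_norm Rn -> has_fundamental_function Rn phi ->
  0 < b <= 1 -> (forall u, I01 u -> phi u <= b^-1 * u) -> phi b = 1 -> Mplus X ->
  ((b^-1)%:E * top_integral X b <= Rn X)%E.
Proof.
move=> [bR riR] fR b01 phib phib1 pX; have /andP[b0 b1] := b01.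
have bi0 : 0 < b^-1 by rewrite invr_gt0.
have [R0 [RZ [RD [RM _]]]] := bR.
have pXs := Mplus_Xstar pX.
(* Rearrangement invariance places the largest values of the function on [[0, b]]. *)
have -> : Rn X = Rn (Xstar X).
  by apply: riR => // l; rewrite equimeasurable_Xstar.
have mb : measurable (`[0, b] : set R) by exact: measurable_itv.
have mXb := measurable_Xstar pX b1.
have X0 x : (`[0, b]%classic : set R) x -> (0 <= Xstar X x)%E.
  by move=> _; exact: Xstar_ge0.
have cI := cvg_integral_mine mb mXb X0.
have cbI : ((b^-1)%:E * \int[lam]_(x in `[0%R, b]) mine (Xstar X x) (n%:R)%:E)%E
    @[n --> \oo] --> ((b^-1)%:E * \int[lam]_(x in `[0%R, b]) Xstar X x)%E.
  by apply: cvgeZl.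
rewrite /top_integral -(cvg_lim _ cbI)//; apply: lime_le; first exact: cvgP cbI.
apply: nearW => n.
pose W : R -> \bar R := fun x => mine (Xstar X x) (n%:R)%:E.
have n0 : 0 <= n%:R :> R by [].
have pW : Mplus W by exact: Mplus_mine.
have W0 x : (0 <= W x)%E by rewrite le_min Xstar_ge0/= lee_fin.
have Wn x : (W x <= (n%:R)%:E)%E by rewrite ge_min lexx orbT.
have Wfin x : W x \is a fin_num.
  by rewrite ge0_fin_numE// (le_lt_trans (Wn x))// ltry.
pose V : R -> \bar R := fun x => ((n%:R)%:E - W x)%E.
have V0 x : (0 <= V x)%E by rewrite /V sube_ge0 ?Wfin ?orbT//.
have mV D : measurable_fun I01 W -> D `<=` I01 -> measurable_fun D V.
  move=> mW DI; apply: emeasurable_funB; first exact: measurable_cst.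
  exact: measurable_funS mW.
pose U : R -> \bar R := fun x => (V x * ind `[0%R, b] x)%E.
have pU : Mplus U.
  split; last by move=> x _; rewrite mule_ge0// lee_fin.
  apply: emeasurable_funM; first by apply: mV => //; exact: (proj1 pW).
  exact/measurable_EFinP/measurable_indic.
have pIb : Mplus (ind (`[0%R, b] : set R)) by exact: Mplus_ind.
have bI := subset_I01 b1.
have RI : Rn (fun x => (n%:R)%:E * ind `[0%R, b] x)%E = (n%:R)%:E.
  by rewrite RZ// fR// lebesgue_0itv ?(ltW b0)//= phib1 mule1.
have IU : (\int[lam]_(x in I01) U x = \int[lam]_(x in `[0%R, b]) V x)%E.
  rewrite [RHS]integral_mkcond [LHS]integral_mkcond; apply: eq_integral => x _.
  rewrite !patchE /U /ind indicE.
  have [xb|xb] := boolP (x \in `[0, b]%classic); last by rewrite mule0; case: ifP.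
  by rewrite mule1 mem_set//; apply: bI; rewrite inE in xb.
(* [V + W] is the constant [n] on [[0, b]], so the two averages add up to [n]. *)
have IVW : ((b^-1)%:E * \int[lam]_(x in `[0%R, b]) V x +
    (b^-1)%:E * \int[lam]_(x in `[0%R, b]) W x = (n%:R)%:E)%E.
  rewrite -ge0_muleDr ?integral_ge0// -ge0_integralD//.
  - under eq_integral => x _ do rewrite /V subeK//.
    rewrite integral_cst// muleCA -[RHS]mule1; congr (_ * _)%E.
    transitivity ((b^-1)%:E * b%:E)%E; last by rewrite -EFinM mulVf ?gt_eqF.
    by congr (_ * _)%E; apply: lebesgue_0itv; exact: ltW.
  - by apply: mV => //; exact: (proj1 pW).
  - by apply: measurable_funS (proj1 pW).
(* Pointwise, [n 1_[0, b]] is at most the rearrangement plus [U]; the norm of the left side is [n]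
   and that of [U] is at most the average of [V]. *)
have key : ((n%:R)%:E <= Rn (Xstar X) + (b^-1)%:E * \int[lam]_(x in `[0%R, b]) V x)%E.
  rewrite -RI -IU.
  apply: (@le_trans _ _ (Rn (Xstar X \+ U)%E)).
    apply: RM; [exact: MplusZ|exact: MplusD|apply: ae01W => x Ix].
    rewrite /U /ind indicE /=; case: (_ \in _); last first.
      by rewrite !mule0 adde0 Xstar_ge0.
    rewrite !mule1 /V.
    have {1}-> : ((n%:R)%:E = W x + ((n%:R)%:E - W x) :> \bar R)%E by rewrite addeC subeK.
    apply: leeD2r.
    by rewrite ge_min lexx.
  apply: le_trans (RD _ _ pXs pU) _; apply: leeD => //.
  by apply: (norm_le_integral bR fR); rewrite ?ltW.
set I1 := ((b^-1)%:E * _)%E in IVW key; set I2 := ((b^-1)%:E * _)%E in IVW.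
have I10 : (0 <= I1)%E by rewrite mule_ge0 ?lee_fin ?(ltW bi0)// integral_ge0.
have I20 : (0 <= I2)%E by rewrite mule_ge0 ?lee_fin ?(ltW bi0)// integral_ge0.
(* Finiteness of the average of [V] allows it to be cancelled between [key] and [IVW]. *)
have fI1 : I1 \is a fin_num.
  by rewrite ge0_fin_numE// (@le_lt_trans _ _ (n%:R)%:E) ?ltry// -IVW leeDl.
have : (I2 <= Rn (Xstar X))%E by rewrite -(leeD2rE _ _ fI1) addeC IVW.
exact.
Qed.

(** * The essential supremum and the jump function *)

Lemma lee_superlevel (x y : \bar R) : (0 <= y)%E ->
  (forall l : R, 0 <= l -> (l%:E < x)%E -> (l%:E <= y)%E) -> (x <= y)%E.
Proof.
case: y => [r| |]// r0 H; rewrite ?leey//; rewrite leNgt; apply/negP.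
case: x H => [s| |]// H; last first.
  have := H (r + 1); rewrite ltry !lee_fin in r0 *; rewrite addr_ge0// => /(_ isT isT).
  by rewrite gerDl leNgt ltr01.
rewrite lte_fin lee_fin in r0 * => rs.
have h0 : 0 <= (r + s) / 2 by lra.
have h1 : (r + s) / 2 < s by lra.
by have := H _ h0; rewrite lte_fin lee_fin => /(_ h1); lra.
Qed.

Lemma ess_sup_Xstar X : Mplus X -> Linf_norm X = Xstar X 0.
Proof.
move=> pX; apply/eqP; rewrite eq_le; apply/andP; split.
  apply: le_ereal_inf_tmp => _ [l [l0 dl] <-]; apply: ereal_inf_lbound => /=.
  apply/ae01P; exists (I01 `&` [set x | (l%:E < X x)%E]); split.
  - exact: measurable_superlevel.
  - by apply/eqP; rewrite eq_le measure_ge0 andbT -distrE.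
  - by move=> x /= /not_implyP[Ix nX]; split=> //=; rewrite ltNge; exact/negP.
apply: le_ereal_inf_tmp => y /= aXy.
(* The essential supremum ranges over all extended real bounds, whereas [Xstar] uses nonnegative
   levels; a negative bound would force [[0, 1]] to be null. *)
have y0 : (0 <= y)%E.
  rewrite leNgt; apply/negP => y0.
  have [A [mA A0 PA]] := ae01_lebesgue aXy.
  have : (lam I01 <= lam A)%E.
    apply: le_measure; rewrite ?inE// => x Ix; apply: PA => /= /(_ Ix) Xy.
    by have := le_lt_trans Xy y0; rewrite ltNge (Mplus_ge0 pX Ix).
  by rewrite A0 lebesgue_I01 leNgt lte_fin ltr01.
apply: lee_superlevel => // l l0; rewrite lt_Xstar// => d0.
rewrite leNgt; apply/negP => yl; move: d0; apply/negP; rewrite -leNgt.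
have [A [mA A0 PA]] := ae01_lebesgue aXy.
rewrite distrE//; apply: (@le_trans _ _ (lam A)); last by rewrite A0.
apply: le_measure; rewrite ?inE//; first exact: measurable_superlevel.
move=> x [Ix /= lX]; apply: PA => /= /(_ Ix) Xy.
by have := lt_trans (le_lt_trans Xy yl) lX; rewrite ltxx.
Qed.

Lemma ae01_le_Xstar0 X l : Mplus X -> Xstar X 0 = l%:E -> ae01 (fun x => X x <= l%:E)%E.
Proof.
move=> pX Xl; have l0 : 0 <= l by rewrite -lee_fin -Xl Xstar_ge0.
apply/ae01P; exists (I01 `&` [set x | (l%:E < X x)%E]); split.
- exact: measurable_superlevel.
- by apply/eqP; rewrite eq_le measure_ge0 andbT -distrE// leNgt -lt_Xstar// Xl ltxx.
- by move=> x /= /not_implyP[Ix nX]; split=> //=; rewrite ltNge; exact/negP.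
Qed.

(** Any superlevel set of positive measure has an indicator of norm [1], so [X >= l 1_{X > l}]
    yields [R(X) >= l] for every [l] below the essential supremum. *)
Lemma norm_eq_Xstar0 (Rn : (R -> \bar R) -> \bar R) phi X :
  banach_function_norm Rn -> has_fundamental_function Rn phi ->
  (forall t, I01 t -> phi t = (if t == 0 then 0 else 1)) -> Mplus X ->
  Rn X = Xstar X 0.
Proof.
move=> bR fR phiE pX; have [R0 [RZ [RD [RM _]]]] := bR.
apply/eqP; rewrite eq_le; apply/andP; split.
  have := Xstar_ge0 X 0; case E : (Xstar X 0) => [l| |]// l0; last exact: leey.
  by apply: norm_le_cst => //; exact: ae01_le_Xstar0.
have p0 : Mplus (cst 0%E : R -> \bar R) by split=> //; exact: measurable_cst.
apply: lee_superlevel.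
  have [_ <-] := R0 _ p0; last exact: ae01W.
  by apply: RM => //; apply: ae01W => x Ix; exact: Mplus_ge0.
move=> l l0; rewrite lt_Xstar// distrE// => d0.
set E := (X in lam X) in d0; have mE : measurable E by exact: measurable_superlevel.
have EI : E `<=` I01 by move=> x [].
have [fE e01] := lebesgue_sub_I01 mE EI.
have RE : Rn (ind E) = 1%E.
  rewrite fR// phiE ?I01E// ifF//; apply/negbTE.
  by rewrite gt_eqF// -lte_fin fineK.
rewrite -[leLHS]mule1 -RE -RZ//; last exact: Mplus_ind.
apply: RM => //; first by apply: MplusZ => //; exact: Mplus_ind.
apply: ae01W => x Ix; rewrite /ind indicE; case: (boolP (x \in E)) => [/[!inE] -[_ /= lX]|_].
  by rewrite mule1 ltW.
by rewrite mule0 Mplus_ge0.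
Qed.

(** * Marcinkiewicz and Lorentz norms in the two extremal cases *)

Lemma le_top_integral_itv X s t : Mplus X -> s <= t -> t <= 1 ->
  (top_integral X s <= top_integral X t)%E.
Proof.
move=> pX st t1; apply: ge0_subset_integral => //.
- exact: measurable_Xstar.
- by move=> x _; exact: Xstar_ge0.
- by apply: subset_itvl; rewrite bnd_simp.
Qed.

(** With [l] the quantile at [s] and [I] the integral of the excess over [l], the average at [s]
    equals [l + I/s], and the average at [t] is at most [l + I/t]. *)
Lemma top_integral_average X s t : Mplus X -> 0 < s -> s <= t -> t <= 1 ->
  ((t^-1)%:E * top_integral X t <= (s^-1)%:E * top_integral X s)%E.
Proof.
move=> pX s0 st t1; have s1 := le_trans st t1; have t0 := lt_le_trans s0 st.
have s01 : 0 <= s <= 1 by rewrite ltW.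
have t01 : 0 <= t <= 1 by rewrite ltW.
have := Xstar_ge0 X s; case EX : (Xstar X s) => [l| |]// l0; last first.
  rewrite (top_integral_pinfty pX _ EX) ?s0// gt0_muley ?leey// lte_fin invr_gt0//.
rewrite lee_fin in l0; rewrite (top_integral_excess pX l0 s01 EX).
apply: (le_trans (lee_wpmul2l _ (top_integral_le pX l0 t01))).
  by rewrite lee_fin invr_ge0 ltW.
have : (0 <= \int[lam]_(x in I01) excess l X x)%E by apply: integral_ge0 => x _; exact: excess_ge0.
move: (\int[lam]_(x in I01) excess l X x)%E => I I0.
rewrite !ge0_muleDr ?lee_fin ?mulr_ge0 ?(ltW s0) ?(ltW t0)//.
rewrite -!EFinM !(mulrCA _ l) !mulVf ?gt_eqF//; apply: leeD => //.
by apply: lee_wpmul2r => //; rewrite lee_fin lef_pV2.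
Qed.

(** The supremum is attained at [b]: before it the factor [phi(t) / t] is constant and [K(t, X)]
    grows; after it [phi = 1] and averages decrease. *)
Lemma marcinkiewicz_top_integral phi b X :
  (forall t, I01 t -> phi t = Num.min (t / b) 1) -> 0 < b <= 1 -> Mplus X ->
  marcinkiewicz_norm phi X = ((b^-1)%:E * top_integral X b)%E.
Proof.
move=> phiE /andP[b0 b1] pX; have bi0 : 0 < b^-1 by rewrite invr_gt0.
apply/eqP; rewrite eq_le; apply/andP; split; last first.
  apply: ereal_sup_ubound; exists b; first by rewrite /= in_itv/= b0.
  by rewrite phiE ?I01E ?(ltW b0)// divff ?gt_eqF// minxx mul1r.
apply: ge_ereal_sup => _ [t /= /[!in_itv]/= /andP[t0 t1] <-].
rewrite phiE ?I01E ?(ltW t0)//; have [tb|bt] := leP (t / b) 1.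
  rewrite mulrAC divff ?gt_eqF// mul1r; apply: lee_wpmul2l; first by rewrite lee_fin ltW.
  by apply: le_top_integral_itv => //; rewrite ler_pdivrMr// mul1r in tb.
rewrite mul1r; apply: top_integral_average => //.
by rewrite ltr_pdivlMr// mul1r in bt; exact: ltW.
Qed.

(** Allows the derivative of [phi] to be ignored at the kink and at [1], where it would depend on
    arbitrary values of [phi] outside [[0, 1]]. Measurability of [f] is inherited from [g]. *)
Lemma integral_eq_off2 (A : set R) (f g : R -> \bar R) (a b : R) : measurable A ->
  measurable_fun A g -> (forall x, A x -> x != a -> x != b -> f x = g x) ->
  (\int[lam]_(x in A) f x = \int[lam]_(x in A) g x)%E.
Proof.
move=> mA mg fg.
have m1 : measurable (A `\ a) by apply: measurableD.
have m2 : measurable (A `\ a `\ b) by apply: measurableD.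
have fg2 x : (A `\ a `\ b) x -> f x = g x.
  by case=> -[Ax /eqP xa] /eqP xb; exact: fg.
have mg1 : measurable_fun (A `\ a) g by apply: measurable_funS mg => // x [].
have mg2 : measurable_fun (A `\ a `\ b) g by apply: measurable_funS mg1 => // x [].
have mf2 : measurable_fun (A `\ a `\ b) f.
  by apply: (eq_measurable_fun g) => // x /[!inE] /fg2.
have mf1 : measurable_fun (A `\ a) f.
  have [Ab|nAb] := pselect ((A `\ a) b); last first.
    rewrite -(_ : (A `\ a) `\ b = A `\ a)//; apply/seteqP; split=> [x []//|x Ax].
    by split=> // xb; apply: nAb; rewrite -xb.
  rewrite -(setD1K Ab); apply/measurable_funU => //.
  by split=> //; exact: measurable_fun_set1.
rewrite -(integral_setD1 m1 mf1) -(integral_setD1 m1 mg1).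
rewrite -(integral_setD1 m2 mf2) -(integral_setD1 m2 mg2).
by apply: eq_integral => x; rewrite inE => /fg2.
Qed.

Lemma derive1_near_eq phi (psi : R -> R) w : (\near w, phi w = psi w) ->
  derive1 phi w = derive1 psi w.
Proof. by move=> H; rewrite !derive1E; apply: near_eq_derive. Qed.

Lemma near_itvoo (a b w : R) (P : R -> Prop) : a < w < b -> (forall x, a < x < b -> P x) ->
  \near w, P w.
Proof.
move=> awb H; have : w \in `]a, b[ by rewrite in_itv.
move=> /near_in_itvoo; apply: filterS => x; rewrite in_itv/=; exact: H.
Qed.

(** The derivative is [1/b] on []0, b[] and [0] on []b, 1[], and the jump term vanishes because
    [phi(0+) = 0]. *)
Lemma lorentz_top_integral phi b X :
  (forall t, I01 t -> phi t = Num.min (t / b) 1) -> 0 < b <= 1 -> Mplus X ->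
  lorentz_norm phi X = ((b^-1)%:E * top_integral X b)%E.
Proof.
move=> phiE /andP[b0 b1] pX; have bi0 : 0 < b^-1 by rewrite invr_gt0.
have phil t : 0 < t < b -> phi t = b^-1 * t.
  move=> /andP[t0 tb]; rewrite phiE ?I01E ?(ltW t0) ?(le_trans (ltW tb))//.
  by rewrite min_l; [rewrite mulrC|rewrite ler_pdivrMr// mul1r ltW].
have phir t : b < t < 1 -> phi t = 1.
  move=> /andP[bt t1]; rewrite phiE ?I01E ?(le_trans (ltW b0) (ltW bt)) ?(ltW t1)//.
  by rewrite min_r// ler_pdivlMr// mul1r ltW.
have lim0 : lim (phi x @[x --> 0%R^'+]) = 0.
  apply: cvg_lim => //.
  have c0 : (fun x : R => b^-1 * x) x @[x --> 0%R^'+] --> (0 : R).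
    rewrite -[X in _ --> X](mulr0 b^-1); apply: cvgM; first exact: cvg_cst.
    by apply: cvg_at_right_filter; exact: cvg_id.
  apply: cvg_trans c0; apply: near_eq_cvg; near=> x.
  by apply/esym/phil/andP; split.
rewrite /lorentz_norm lim0 mule0 add0e.
pose g (w : R) : \bar R := ((b^-1)%:E * (Xstar X w * ind `]0%R, b[ w))%E.
have s01 : `]0, 1]%classic `<=` @I01 R.
  by move=> x /=; rewrite I01E in_itv/= => /andP[/ltW -> ->].
have mXi : measurable_fun (`]0, 1] : set R) (fun w => Xstar X w * ind `]0%R, b[ w)%E.
  apply: emeasurable_funM.
    by apply: measurable_funS (proj1 (Mplus_Xstar pX)).
  exact/measurable_EFinP/measurable_indic.
rewrite (@integral_eq_off2 _ _ g b 1) //; last 2 first.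
- by apply: emeasurable_funM => //; exact: measurable_cst.
- move=> x /=; rewrite in_itv/= => /andP[x0 x1] xb xn1.
  have {xn1}x1 : x < 1 by rewrite lt_neqAle xn1.
  rewrite /g /ind indicE; case: (ltgtP x b) xb => [xb _|bx _|_ //].
    rewrite mem_set/= ?in_itv/= ?x0// mule1 muleC; congr (_%:E * _)%E.
    have -> := @derive1_near_eq phi (fun x => b^-1 * x) x _.
      by rewrite derive1E deriveMl// derive_id mulr1.
    by apply: (@near_itvoo 0 b); [rewrite x0|].
  rewrite memNset/=; last by rewrite in_itv/= x0/= ltNge (ltW bx).
  have -> := @derive1_near_eq phi (cst 1) x _; first by rewrite derive1_cst !mule0.
  by apply: (@near_itvoo b 1); [rewrite bx|].
rewrite ge0_integralZl//; last 2 first.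
- by move=> x _; rewrite mule_ge0 ?Xstar_ge0// lee_fin.
- by rewrite lee_fin ltW.
congr (_ * _)%E.
transitivity (\int[lam]_(x in `]0%R, b[) Xstar X x)%E.
  rewrite [RHS]integral_mkcond [LHS]integral_mkcond; apply: eq_integral => x _.
  rewrite !patchE /ind indicE.
  have [xb|xb] := boolP (x \in `]0, b[%classic); last by rewrite mule0; case: ifP.
  rewrite mule1 mem_set//=; rewrite inE/= !in_itv/= in xb *.
  by case/andP: xb => -> /ltW xb; rewrite (le_trans xb).
rewrite /top_integral -(@integral_itv_bndoo _ 0 b _ true false)//.
apply: measurable_funS (proj1 (Mplus_Xstar pX)) => // x /=.
by rewrite I01E in_itv/= => /andP[/ltW -> /ltW xb]; rewrite (le_trans xb).
Unshelve. all: by end_near. Qed.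

Lemma marcinkiewicz_Xstar0 phi X :
  (forall t, I01 t -> phi t = (if t == 0 then 0 else 1)) -> Mplus X ->
  marcinkiewicz_norm phi X = Xstar X 0.
Proof.
move=> phiE pX; apply/eqP; rewrite eq_le; apply/andP; split.
  apply: ge_ereal_sup => _ [t /= /[!in_itv]/= /andP[t0 t1] <-].
  rewrite phiE ?I01E ?(ltW t0)// gt_eqF// div1r.
  have ti : (0 <= (t^-1)%:E :> \bar R)%E by rewrite lee_fin invr_ge0 ltW.
  apply: (@le_trans _ _ ((t^-1)%:E * \int[lam]_(x in `[0%R, t]) cst (Xstar X 0) x)%E).
    apply: lee_wpmul2l => //; apply: ge0_le_integral => //.
    - by move=> x _; exact: Xstar_ge0.
    - exact: measurable_Xstar.
    - by move=> x /=; rewrite in_itv/= => /andP[x0 _]; exact: Xstar_nonincreasing.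
  rewrite integral_cst// muleCA -[leRHS]mule1.
  apply: lee_wpmul2l; first exact: Xstar_ge0.
  apply: (@le_trans _ _ ((t^-1)%:E * t%:E)%E); last by rewrite -EFinM mulVf ?gt_eqF.
  apply: lee_wpmul2l => //; have := lebesgue_0itv (ltW t0) => <-; exact: lexx.
apply: lee_superlevel.
  apply: le_trans (ereal_sup_ubound _); last by exists 1; [rewrite /= in_itv/= ltr01 lexx|].
  by rewrite mule_ge0 ?integral_ge0// ?lee_fin ?divr_ge0// ?phiE ?I01E ?ler01 ?lexx ?oner_eq0//=;
    move=> x _; exact: Xstar_ge0.
move=> l l0; rewrite lt_Xstar// => d0; have d1 := distr_le1 l pX.
have fd := distr_fin_num l pX.
(* On [[0, t[] the rearrangement exceeds [l], so its average there is at least [l]. *)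
pose t := fine (distr X l).
have t0 : 0 < t by rewrite -lte_fin fineK.
have t1 : t <= 1 by rewrite -lee_fin fineK.
apply: (@le_trans _ _ ((phi t / t)%:E * top_integral X t)%E); last first.
  by apply: ereal_sup_ubound; exists t => //=; rewrite in_itv/= t0.
rewrite phiE ?I01E ?(ltW t0)// gt_eqF// div1r.
have ti : (0 <= (t^-1)%:E :> \bar R)%E by rewrite lee_fin invr_ge0 ltW.
have mX : measurable_fun (`[0, t[ : set R) (Xstar X).
  apply: measurable_funS (measurable_Xstar pX t1) => //.
  by apply: subset_itvl; rewrite bnd_simp.
(* The endpoint is dropped because the rearrangement is at most [l] at [t] itself. *)
rewrite /top_integral -(integral_itv_bndo_bndc mX).
apply: (@le_trans _ _ ((t^-1)%:E * \int[lam]_(x in `[0%R, t[) cst l%:E x)%E).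
  rewrite integral_cst// muleCA -[leLHS]mule1.
  apply: lee_wpmul2l; first by rewrite lee_fin.
  apply: (@le_trans _ _ ((t^-1)%:E * t%:E)%E); first by rewrite -EFinM mulVf ?gt_eqF.
  apply: lee_wpmul2l => //; have := lebesgue_0ito (ltW t0) => <-; exact: lexx.
apply: lee_wpmul2l => //; apply: ge0_le_integral => //.
by move=> x /=; rewrite in_itv/= => /andP[x0 xt]; rewrite ltW// lt_Xstar// -[X in (_ < X)%E]fineK// lte_fin.
Qed.

Lemma lorentz_Xstar0 phi X :
  (forall t, I01 t -> phi t = (if t == 0 then 0 else 1)) -> Mplus X ->
  lorentz_norm phi X = Xstar X 0.
Proof.
move=> phiE pX.
have phi1 t : 0 < t < 1 -> phi t = 1.
  by move=> /andP[t0 t1]; rewrite phiE ?I01E ?(ltW t0) ?(ltW t1)// gt_eqF.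
have lim1 : lim (phi x @[x --> 0%R^'+]) = 1.
  apply: cvg_lim => //.
  have c1 : (fun x : R => 1 : R) x @[x --> 0%R^'+] --> (1 : R) by exact: cvg_cst.
  apply: cvg_trans c1; apply: near_eq_cvg; near=> x.
  by apply/esym/phi1/andP; split.
(* The whole norm sits in the jump term. The endpoint [1] is the one exceptional point, hence passed
   twice. *)
rewrite /lorentz_norm lim1 mule1 (@integral_eq_off2 _ _ (cst 0%E) 1 1)//.
- by rewrite integral0 adde0.
- move=> x /=; rewrite in_itv/= => /andP[x0 x1] xn1 _.
  have {xn1}x1 : x < 1 by rewrite lt_neqAle xn1.
  have -> := @derive1_near_eq phi (cst 1) x _; first by rewrite derive1_cst !mule0.
  by apply: (@near_itvoo 0 1); [rewrite x0|].
Unshelve. all: by end_near. Qed.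

(** * Rigidity *)

Section forward.
Variable phi : R -> R.
Hypothesis cphi : concave_on01 phi.
Hypothesis rphi : forall t, I01 t -> 0 <= phi t <= 1.
Hypothesis phi0 : phi 0 = 0.
Hypothesis phi1 : phi 1 = 1.

Lemma le_concave01 t : 0 <= t <= 1 -> t <= phi t.
Proof.
move=> /andP[t0 t1]; have := concave01_star cphi phi0 t0 t1 ltr01 (lexx _).
by rewrite divr1 phi1 mulr1.
Qed.

(* The piece is the linear combination of [K(s)] and [K(1)] that is the Lorentz norm of the
   piecewise linear interpolation of [phi] at [0], [s] and [1]. *)
Lemma admissible_interpolation (s : R) (b := (1 - phi s) / (1 - s)) :
  0 < s < 1 -> admissible phi (phi s / s - b, b, s).
Proof.
move=> /andP[s0 s1].
have Is : I01 s by rewrite I01E !ltW.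
have /andP[ps0 ps1] := rphi Is.
have ds : 0 < 1 - s by rewrite subr_gt0.
have b0 : 0 <= b by rewrite divr_ge0 ?subr_ge0// ltW.
have sp : s <= phi s by apply: le_concave01; rewrite !ltW.
have bs : b * (1 - s) = 1 - phi s by rewrite /b divfK ?gt_eqF.
have pss : phi s / s * s = phi s by rewrite divfK ?gt_eqF.
have I1 : I01 (1 : R) by rewrite I01E ler01 lexx.
split=> //.
(* The slope before [s] is at least the slope after it; cleared of denominators, this is
   [s <= phi s]. *)
- rewrite subr_ge0 /b ler_pdivrMr// mulrAC ler_pdivlMr//.
  nra.
- by rewrite s0 ltW.
(* Up to [s] the minorant is the chord from [0]; beyond [s] it is the chord from [(s, phi s)] to
   [(1, 1)]. *)
move=> u Iu; have := Iu; rewrite I01E => /andP[u0 u1]; rewrite minElt; case: ltP => su; last first.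
  rewrite mulrBl subrK mulrC mulrA mulrAC.
  exact: (concave01_star cphi phi0 u0 su s0 (ltW s1)).
have l01 : 0 <= (1 - u) / (1 - s) <= 1.
  by rewrite divr_ge0 ?subr_ge0// ?(ltW s1)//= ler_pdivrMr// mul1r lerD2l lerN2 ltW.
have := cphi Is I1 l01; rewrite phi1.
have -> : (1 - u) / (1 - s) * s + (1 - (1 - u) / (1 - s)) * 1 = u.
  by field; rewrite gt_eqF.
apply: le_trans; rewrite mulrBl pss.
rewrite le_eqVlt; apply/orP; left; apply/eqP; rewrite /b.
by field; rewrite gt_eqF.
Qed.

Let X1 (s : R) : R -> \bar R := (ind (@I01 R) \+ ind `[0%R, s])%E.

Lemma Mplus_two_step (s : R) : Mplus (X1 s).
Proof. by apply: MplusD; apply: Mplus_ind. Qed.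

(** For the interpolating piece, [2 s a + (1 + s) b = 2 phi(s) + b (1 - s) = 1 + phi(s)]. *)
Lemma sup_norm_two_step (s : R) : 0 < s < 1 ->
  ((1 + phi s)%:E <= sup_norm phi (X1 s))%E.
Proof.
move=> s01; have /andP[s0 s1] := s01.
apply: le_trans (piece_le (X1 s) (admissible_interpolation s01)) => /=.
have [a0 b0 _ _] := admissible_interpolation s01.
set b := (1 - phi s) / (1 - s) in a0 b0 *; set a := _ - b in a0 *.
have mIs : measurable (`[0%R, s] : set R) by exact: measurable_itv.
have IsI := subset_I01 (ltW s1).
have pX := Mplus_two_step s.
have t1 : top_integral (X1 s) 1 = (1 + s)%:E.
  rewrite top_integral1// ge0_integralD//.
  - rewrite !integral_indic// setIid EFinD -lebesgue_I01 -(lebesgue_0itv (ltW s0)).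
    by rewrite (setIidl IsI).
  - by move=> x _; rewrite lee_fin.
  - exact: (proj1 (Mplus_ind measurable_I01)).
  - by move=> x _; rewrite lee_fin.
  - exact: (proj1 (Mplus_ind mIs)).
have ts : ((2 * s)%:E <= top_integral (X1 s) s)%E.
  have pi := Mplus_ind mIs.
  have e : top_integral (fun x => 2%:E * ind `[0%R, s] x)%E s = (2 * s)%:E.
    rewrite top_integralZ ?(ltW s1)// top_integral_ind// ?(ltW s0) ?(ltW s1)//.
    by rewrite lebesgue_0itv ?(ltW s0)//= minxx.
  rewrite -e; apply: le_top_integral => //; [exact: MplusZ|exact: ltW|].
  apply: ae01W => x Ix; rewrite /X1 /ind /= !indicE (mem_set Ix).
  by case: (_ \in _); rewrite ?mulr1 ?mule1 ?mule0 ?adde0 ?lee_fin// -EFinD lee_fin.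
rewrite t1; apply: (@le_trans _ _ (a%:E * (2 * s)%:E + b%:E * (1 + s)%:E)%E); last first.
  by apply: leeD => //; apply: lee_wpmul2l => //; rewrite lee_fin.
rewrite -!EFinM -EFinD lee_fin le_eqVlt; apply/orP; left; apply/eqP.
rewrite /a /b; field.
by rewrite !gt_eqF// subr_gt0.
Qed.

Lemma top_integral_two_step (s t : R) : 0 < s < 1 -> 0 < t <= 1 ->
  (top_integral (X1 s) t <= (t + Num.min t s)%:E)%E.
Proof.
move=> /andP[s0 s1] t01; have /andP[t0 t1] := t01.
have mIs : measurable (`[0%R, s] : set R) by exact: measurable_itv.
have IsI := subset_I01 (ltW s1).
apply: le_trans (top_integralD_le _ _ t01) _; [exact: Mplus_ind|exact: Mplus_ind|].
rewrite !top_integral_ind// ?(ltW t0)//.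
by rewrite lebesgue_I01 lebesgue_0itv ?(ltW s0)//= min_l// -EFinD.
Qed.

Hypothesis marc : forall X, Mplus X -> marcinkiewicz_norm phi X = sup_norm phi X.

(** The slack [e] stands in for a maximiser, since the supremum defining the Marcinkiewicz norm is
    not known to be attained. *)
Lemma marcinkiewicz_two_step (s e : R) : 0 < s < 1 -> 0 < e ->
  exists2 t, 0 < t <= 1 & 1 + phi s - e < phi t + phi t / t * Num.min t s.
Proof.
move=> s01 e0.
have : ((1 + phi s - e)%:E < marcinkiewicz_norm phi (X1 s))%E.
  rewrite marc; last exact: Mplus_two_step.
  apply: lt_le_trans (sup_norm_two_step s01).
  by rewrite lte_fin ltrBlDr ltrDl.
move=> /ereal_sup_gt[_ [t /= /[!in_itv]/= t01 <-]] H; exists t => //.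
have /andP[t0 t1] := t01.
have pt0 : 0 <= phi t / t.
  by have := rphi (t := t); rewrite I01E (ltW t0) => /(_ t1)/andP[p0 _]; rewrite divr_ge0// ltW.
rewrite -lte_fin; apply: (lt_le_trans H).
apply: (@le_trans _ _ ((phi t / t)%:E * (t + Num.min t s)%:E)%E).
  by apply: lee_wpmul2l; [rewrite lee_fin|exact: top_integral_two_step].
by rewrite -EFinM lee_fin mulrDr divfK ?gt_eqF.
Qed.

(** If [phi(s)] exceeded [s / u], a nearly maximising [t] would have to lie beyond [u]; but there
    [phi(t) / t <= 1 / u], too small to reach [1 + phi(s)]. *)
Lemma phi_le_chord (s u : R) : 0 < s -> s < u -> u <= 1 -> phi u < 1 -> phi s <= s / u.
Proof.
move=> s0 su u1 pu.
have s1 : s < 1 by exact: lt_le_trans u1.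
have s01 : 0 < s < 1 by rewrite s0.
have nd (x y : R) : 0 <= x -> x <= y -> y <= 1 -> phi x <= phi y.
  by move=> *; exact: concave01_nondecreasing.
have psu : phi s <= phi u by apply: nd; rewrite // ltW.
rewrite leNgt; apply/negP => H.
(* The first bound rules out [t <= u], where [phi(t) <= phi(u)]; the second contradicts what is left
   for [t > u]. *)
pose e := Num.min (1 - phi u) (phi s - s / u).
have e0 : 0 < e by rewrite lt_min !subr_gt0 pu.
have e1 : e <= 1 - phi u by rewrite ge_min lexx.
have e2 : e <= phi s - s / u by rewrite ge_min lexx orbT.
have [t /andP[t0 t1]] := marcinkiewicz_two_step s01 e0.
have /andP[pt0 pt1] : 0 <= phi t <= 1 by apply: rphi; rewrite I01E (ltW t0).
have ptt : phi t / t * t = phi t by rewrite divfK ?gt_eqF.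
rewrite minElt; case: (ltP t s) => [ts|st] K.
  have := nd _ _ (ltW t0) (ltW ts) (ltW s1); rewrite ptt in K; lra.
have star := concave01_star cphi phi0 (ltW s0) st t0 t1.
have star' : phi t / t * s <= phi s by rewrite mulrAC (mulrC (phi t)) mulrAC.
have ut : u < t.
  rewrite ltNge; apply/negP => tu.
  by have := nd _ _ (ltW t0) tu u1; lra.
have : phi t / t * s <= s / u.
  rewrite [leRHS]mulrC; apply: ler_wpM2r; first exact: ltW.
  rewrite ler_pdivrMr//; apply: (le_trans pt1).
  by rewrite mulrC ler_pdivlMr ?(lt_trans s0 su)// mul1r ltW.
lra.
Qed.

(** With [b] the supremum of the points where [phi < 1], star-shapedness gives [phi(t) >= t / b]
    below [b], and [phi_le_chord] with [u] tending to [b] gives the reverse. *)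
Lemma marcinkiewicz_rigidity :
  (exists2 alpha : R, 0 <= alpha < 1 &
       forall t, I01 t -> phi t = Num.min (t / (1 - alpha)) 1)
    \/ (forall t, I01 t -> phi t = (if t == 0 then 0 else 1)).
Proof.
have nd (x y : R) : 0 <= x -> x <= y -> y <= 1 -> phi x <= phi y.
  by move=> *; exact: concave01_nondecreasing.
pose S := [set t : R | 0 < t <= 1 /\ phi t < 1].
have [[t0 St0]|nS] := pselect (exists t, S t); last first.
  right=> t It; have := It; rewrite I01E => /andP[t0 t1].
  case: eqP => [->//|/eqP tn0].
  have /andP[_ pt1] := rphi It; apply/eqP; rewrite eq_le pt1/= leNgt; apply/negP => pt.
  by apply: nS; exists t; split=> //; rewrite lt0r tn0 t0.
left.
have hS : has_sup S.
  by split; [exists t0|exists 1 => x [/andP[]]].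
pose b := sup S.
have b0 : 0 < b.
  by have [/andP[t00 _] _] := St0; apply: (lt_le_trans t00); apply: sup_upper_bound.
have b1 : b <= 1 by apply: ge_sup; [exists t0|move=> x [/andP[]]].
have pgt t : b < t -> t <= 1 -> phi t = 1.
  move=> bt t1; have tp := lt_trans b0 bt.
  have /andP[_ pt1] : 0 <= phi t <= 1 by apply: rphi; rewrite I01E (ltW tp).
  apply/eqP; rewrite eq_le pt1/= leNgt; apply/negP => pt.
  have : t <= b by apply: sup_upper_bound => //; split=> //; rewrite tp.
  by rewrite leNgt bt.
have pb : phi b = 1.
  have /andP[pb0 pb1] : 0 <= phi b <= 1 by apply: rphi; rewrite I01E (ltW b0).
  apply/eqP; rewrite eq_le pb1/= leNgt; apply/negP => pb.
  have bpb : b <= phi b by apply: le_concave01; rewrite (ltW b0).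
  have p0 : 0 < phi b by exact: lt_le_trans bpb.
  have lb1 : b < 1 by rewrite lt_neqAle b1 andbT; apply: contraTneq pb => ->; rewrite phi1 ltxx.
  (* Midpoint of [b] and [b / phi b], the abscissa where the ray from [0] through [(b, phi b)]
     reaches height [1]. To the right of [b] the function is already [1], so at [v <= q] it would
     lie above that ray, against star-shapedness. *)
  pose q := b * (phi b + 1) / (2 * phi b).
  have qE : q * phi b = b * (phi b + 1) / 2 by rewrite /q; field; rewrite gt_eqF.
  have bq : b < q by rewrite -(ltr_pM2r p0) qE; nra.
  pose v := Num.min 1 q.
  have bv : b < v by rewrite lt_min lb1.
  have v1 : v <= 1 by rewrite ge_min lexx.
  have vq : v <= q by rewrite ge_min lexx orbT.
  have v0 := lt_trans b0 bv.
  have := concave01_star cphi phi0 (ltW b0) (ltW bv) v0 v1.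
  rewrite (pgt _ bv v1) mulr1 ler_pdivrMr// mulrC => H.
  have : v * phi b <= q * phi b by rewrite ler_pM2r.
  rewrite qE; nra.
exists (1 - b); first by rewrite subr_ge0 b1 ltrBlDr ltrDl.
move=> t It; have := It; rewrite I01E opprB addrCA subrr addr0 => /andP[tp t1].
have [bt|tb] := leP b t.
  rewrite min_r; last by rewrite ler_pdivlMr// mul1r.
  by move: bt; rewrite le_eqVlt => /predU1P[<-//|bt]; exact: pgt.
rewrite min_l; last by rewrite ler_pdivrMr// mul1r ltW.
have [->|tn0] := eqVneq t 0; first by rewrite phi0 mul0r.
have {tn0}tp : 0 < t by rewrite lt0r tn0.
apply/eqP; rewrite eq_le; apply/andP; split; last first.
  by have := concave01_star cphi phi0 (ltW tp) (ltW tb) b0 b1; rewrite pb mulr1.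
have pt0 : 0 < phi t by apply: lt_le_trans (le_concave01 _) => //; rewrite (ltW tp).
rewrite leNgt; apply/negP => H.
have tpb : t / phi t < b by move: H; rewrite !ltr_pdivrMr// mulrC.
(* Since [phi t > t / b], the point [t / phi t] is below [b], leaving room for a [u] with
   [phi u < 1] and [t / u < phi t]. *)
have [u [/andP[u0 u1] pu] gu] : exists2 u, S u & Num.max t (t / phi t) < u.
  by apply: sup_gt; [exists t0|rewrite gt_max tb].
move: gu; rewrite gt_max => /andP[tu tpu].
have := phi_le_chord tp tu u1 pu; rewrite ler_pdivlMr// mulrC leNgt.
by rewrite ltr_pdivrMr// in tpu; rewrite tpu.
Qed.

End forward.

End RearrangementInvariantNorms.

Theorem theorem20 (R : realType) (phi : R -> R)
  (phi_concave : concave_on01 phi)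
  (phi_range : forall t, I01 t -> 0 <= phi t <= 1)
  (phi0 : phi 0 = 0) (phi1 : phi 1 = 1) :
  (* equivalence *)
  ((forall Rn : (R -> \bar R) -> \bar R,
      ri_function_norm Rn -> has_fundamental_function Rn phi ->
      forall X, Mplus X ->
        marcinkiewicz_norm phi X = Rn X /\ Rn X = lorentz_norm phi X)
   <->
   ((exists2 alpha : R, 0 <= alpha < 1 &
       forall t, I01 t -> phi t = Num.min (t / (1 - alpha)) 1)
    \/ (forall t, I01 t -> phi t = (if t == 0 then 0 else 1))))
  /\
  (* the CVaR case *)
  (forall alpha : R, 0 <= alpha < 1 ->
     (forall t, I01 t -> phi t = Num.min (t / (1 - alpha)) 1) ->
     forall X, Mplus X ->
       marcinkiewicz_norm phi X = CVaR alpha X /\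
       lorentz_norm phi X = CVaR alpha X /\
       (forall Rn : (R -> \bar R) -> \bar R,
          ri_function_norm Rn -> has_fundamental_function Rn phi ->
          Rn X = CVaR alpha X))
  /\
  (* the L^oo case *)
  ((forall t, I01 t -> phi t = (if t == 0 then 0 else 1)) ->
     forall X, Mplus X ->
       marcinkiewicz_norm phi X = Linf_norm X /\
       lorentz_norm phi X = Linf_norm X /\
       (forall Rn : (R -> \bar R) -> \bar R,
          ri_function_norm Rn -> has_fundamental_function Rn phi ->
          Rn X = Linf_norm X)).
Proof.
have cvar alpha : 0 <= alpha < 1 ->
    (forall t, I01 t -> phi t = Num.min (t / (1 - alpha)) 1) ->
    forall X, Mplus X ->
      marcinkiewicz_norm phi X = CVaR alpha X /\
      lorentz_norm phi X = CVaR alpha X /\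
      (forall Rn : (R -> \bar R) -> \bar R,
         ri_function_norm Rn -> has_fundamental_function Rn phi ->
         Rn X = CVaR alpha X).
  move=> /andP[a0 a1] phiE X pX.
  have b01 : 0 < 1 - alpha <= 1 by rewrite subr_gt0 a1 gerBl.
  split; first exact: marcinkiewicz_top_integral.
  split; first exact: lorentz_top_integral.
  move=> Rn riR fR; have /andP[b0 b1] := b01.
  have phib u : I01 u -> phi u <= (1 - alpha)^-1 * u.
    by move=> Iu; rewrite phiE// ge_min mulrC lexx.
  apply/eqP; rewrite eq_le (norm_le_top_integral (proj1 riR) fR b01 phib pX)/=.
  apply: (top_integral_le_norm riR fR b01 phib) => //.
  by rewrite phiE ?I01E ?(ltW b0)// divff ?gt_eqF// minxx.
have linf : (forall t, I01 t -> phi t = (if t == 0 then 0 else 1)) ->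
    forall X, Mplus X ->
      marcinkiewicz_norm phi X = Linf_norm X /\
      lorentz_norm phi X = Linf_norm X /\
      (forall Rn : (R -> \bar R) -> \bar R,
         ri_function_norm Rn -> has_fundamental_function Rn phi ->
         Rn X = Linf_norm X).
  move=> phiE X pX; rewrite ess_sup_Xstar//; split; first exact: marcinkiewicz_Xstar0.
  split; first exact: lorentz_Xstar0.
  by move=> Rn [bR _] fR; exact: (norm_eq_Xstar0 bR fR).
split; last by split.
split=> [coincide|].
  apply: marcinkiewicz_rigidity => // X pX.
  have riS := ri_sup_norm phi_concave phi_range phi0 phi1.
  have fS := sup_norm_fundamental phi_concave phi_range phi0 phi1.
  by have [] := coincide _ riS fS X pX.
case=> [[alpha a01 phiE]|phiE] Rn riR fR X pX.
  by have [-> [-> ->]] := cvar alpha a01 phiE X pX.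
by have [-> [-> ->]] := linf phiE X pX.
Qed.
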